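(* Let $A_n$ denote the alternating group on $n$ letters. (1) Let $K$ be any field with $\operatorname{char}K\neq 2$. Then $\operatorname{ed}_K(A_3)=1$; $\operatorname{ed}_K(A_4)=\operatorname{ed}_K(A_5)=2$; $\operatorname{ed}_K(A_{n+4})\ge \operatorname{ed}_K(A_n)+2$ for $n\ge 4$; and $\operatorname{ed}_K(A_n)\ge 2\lfloor\frac{n}{4}\rfloor$ for $n\ge 3$. (2) Let $K$ be any field such that $K\supset\mathbb{F}_4$. Then $\operatorname{ed}_K(A_{n+3})\ge\operatorname{ed}_K(A_n)+1$ for any positive integer $n\neq 4$. (3) If $K$ is a field with $\operatorname{char}K=2$, then $\operatorname{ed}_K(A_n)\ge \lfloor\frac{n}{3}\rfloor$ for $n\ge 3$.
   Context: $\mathbb{F}_4$ is the field with four elements. All fields are assumed to contain the ground field $K$. Let $L/L_0$ be a finite separable extension of fields containing $K$. For an intermediate field $K\subset E_0\subset L_0$, one says that $L/L_0$ is defined over $E_0$ if there is a field $E$ with $E_0\subset E\subset L$, $[E:E_0]=[L:L_0]$ and $L=EL_0$. The essential dimension $\operatorname{ed}_K(L/L_0)$ is the minimum of $\operatorname{trdeg}_K E_0$ (transcendence degree over $K$), where $E_0$ runs over all such fields over which $L/L_0$ is defined. For a finite group $G$, define $\operatorname{ed}_K(G)=\operatorname{ed}_K(K(V)/K(V)^G)$, where $G\to GL(V)$ is a faithful finite-dimensional representation over $K$, $K(V)=K(x_1,\ldots,x_n)$ is the rational function field in a basis $x_1,\ldots,x_n$ of the dual space of $V$ with the induced $G$-action,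 and $K(V)^G$ is the fixed field; this does not depend on the choice of the faithful representation. *)

(* Defs.v *)
From HB Require Import structures.
From mathcomp Require Import all_boot all_order all_algebra.
From mathcomp Require Import all_fingroup all_solvable all_character.
From mathcomp Require Import generic_quotient fraction.
From mathcomp Require Import boolp classical_sets.
From mathcomp Require Import mpoly.

Set Implicit Arguments.
Unset Strict Implicit.
Unset Printing Implicit Defensive.

Import GRing.Theory.

Local Open Scope classical_set_scope.
Local Open Scope ring_scope.

(* Every field of a tower K <= E0 <= E, L0 <= L is a subset of one top field L,
   into which the ground field K is embedded by iota. *)
Definition subfield_over (K L : fieldType) (iota : {rmorphism K -> L})
    (F : set L) : Prop :=
  range iota `<=` F /\ GRing.divring_closed (mem F).

Definition field_gen (K L : fieldType) (iota : {rmorphism K -> L})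
    (A : set L) : set L :=
  smallest (subfield_over iota) A.

Definition is_degree (L : fieldType) (E F : set L) (m : nat) : Prop :=
  exists2 b : 'I_m -> L, (forall i, E (b i)) &
    forall x, E x -> exists! c : {ffun 'I_m -> L},
      (forall i, F (c i)) /\ x = \sum_(i < m) c i * b i.

Definition alg_independent (K L : fieldType) (iota : {rmorphism K -> L})
    (d : nat) (t : 'I_d -> L) : Prop :=
  forall p : {mpoly K[d]}, mmap iota t p = 0 -> p = 0.

Definition algebraic_over (L : fieldType) (F : set L) (x : L) : Prop :=
  exists p : {poly L}, [/\ p \is a polyOver (mem F), p != 0 & root p x].

Definition is_trdeg (K L : fieldType) (iota : {rmorphism K -> L})
    (E : set L) (d : nat) : Prop :=
  exists t : 'I_d -> L,
    [/\ forall i, E (t i), alg_independent iota t &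
        forall x, E x -> algebraic_over (field_gen iota (range t)) x].

Definition defined_over (K L : fieldType) (iota : {rmorphism K -> L})
    (L0 E0 : set L) : Prop :=
  exists E : set L,
    [/\ subfield_over iota E, E0 `<=` E,
        exists2 m, is_degree E E0 m & is_degree [set: L] L0 m &
        field_gen iota (E `|` L0) = [set: L]].

(* Meaningful when L / L0 is finite separable. *)
Definition is_ed_ext (K L : fieldType) (iota : {rmorphism K -> L})
    (L0 : set L) (d : nat) : Prop :=
  let candidate E0 :=
    [/\ subfield_over iota E0, E0 `<=` L0 & defined_over iota L0 E0] in
  (exists2 E0, candidate E0 & is_trdeg iota E0 d) /\
  (forall E0 e, candidate E0 -> is_trdeg iota E0 e -> (d <= e)%N).

Definition ratfield (K : fieldType) (n : nat) : fieldType :=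
  {fraction {mpoly K[n]}}.

Definition ratfield_const (K : fieldType) (n : nat) :
    {rmorphism K -> ratfield K n} :=
  (@tofrac {mpoly K[n]} \o @mpolyC n K).

(* Vectors of V are row vectors and g acts by v |-> v *m A with A = rG g, so the
   coordinate 'X_i is sent to v |-> (v *m A) 0 i. *)
Definition lin_subst (K : fieldType) (n : nat) (A : 'M[K]_n)
    (p : {mpoly K[n]}) : {mpoly K[n]} :=
  p \mPo [tuple \sum_(j < n) A j i *: 'X_j | i < n].

Definition ratfield_act (K : fieldType) (n : nat) (A : 'M[K]_n)
    (f : ratfield K n) : ratfield K n :=
  tofrac (lin_subst A \n_(repr f)) / tofrac (lin_subst A \d_(repr f)).

Definition fixed_ratfield (K : fieldType) (gT : finGroupType) (G : {group gT})
    (n : nat) (rG : mx_representation K G n) : set (ratfield K n) :=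
  [set f | forall g, g \in G -> ratfield_act (rG g) f = f].

(* The value does not depend on the faithful representation, and the regular
   representation is faithful; the default value 0 is never used. *)
Definition ed (K : fieldType) (gT : finGroupType) (G : {group gT}) : nat :=
  xget 0%N [set d | exists n (rG : mx_representation K G n),
    mx_faithful rG /\ is_ed_ext (ratfield_const K n) (fixed_ratfield rG) d].

Definition ed_Alt (K : fieldType) (n : nat) : nat := ed K 'Alt_('I_n)%G.

Definition contains_F4 (K : fieldType) : Prop :=
  exists F4 : finFieldType, #|F4| = 4 /\ inhabited {rmorphism F4 -> K}.

(* Main.v *)
From HB Require Import structures.
From mathcomp Require Import all_boot all_order all_algebra.
From mathcomp Require Import all_fingroup all_solvable all_character.
From mathcomp Require Import generic_quotient fraction fieldext finfield.
From mathcomp Require Import boolp classical_sets.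
From mathcomp Require Import mpoly.
Require Import Defs.
From mathcomp Require Import ring zify.

(** Write L / L^G for a faithful finite group action on a field L over K. The
    first step replaces the descent of L / L^G by actions: a field E that
    realizes the descent to E0 lies in the relative algebraic closure of E0,
    which is stable under G, acted on faithfully, and of the same transcendence
    degree; conversely a stable faithful subfield F gives E0 = F^G by Artin's
    theorem. So ed(L / L^G) is the least transcendence degree of a stable
    faithful subfield ([ed_extP]). Such a subfield is recorded by a finite stable
    set of elements on which G acts faithfully, algebraic over d elements
    ([compressible]).

    For L = K(V) such a set specializes to every faithful G-field M over K with
    infinite fixed field: by Hilbert 90 the equivariant M-points of V are dense,
    so one of them avoids the finitely many denominators and numerators that
    matter ([generic_point], [compressible_transfer]). Hence the value does not
    depend on V, and it can only drop when G shrinks or K grows ([edP],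
    [ed_le_hom], [ed_le_base_change]).

    Lower bounds come from a central factor C of prime order p different from the
    characteristic, with a faithful character chi over K. Compress G x C inside
    M = L(T), where L is a faithful G-field and C acts on T by chi, and restrict
    the T-adic valuation to the compression F. Its residue field lies in L and
    has transcendence degree at least one less, because a uniformizer can be
    added to lifts of residues. The inertia group contains C. Its wild part is a
    normal subgroup of order a power of the characteristic, and modulo the wild
    part it acts faithfully on a uniformizer through roots of unity, so it is
    cyclic. If every solvable normal subgroup of G x C has exponent p, the wild
    part is trivial and inertia is exactly C, so G acts faithfully on the residue
    field and ed(G x C) >= ed(G) + 1 ([compressible_residue], [ed_le_prod]).

    The condition holds for A_n x C with n >= 5, since A_n is simple and not
    solvable, and for groups of exponent p. It is applied to A_n x Z/2 x Z/2
    inside A_(n+4) in characteristic different from 2, and to A_n x Z/3 inside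
    A_(n+3) when K has a primitive cube root of unity; in characteristic 2 such a
    root is adjoined first. For n = 4 and p = 2 the group (Z/2)^4 inside A_8
    replaces A_4 x Z/2 x Z/2. A nontrivial group has positive essential dimension
    because K is algebraically closed in K(V) ([algebraic_constant]).

    The upper bounds for A_3 and A_5 use the ratios of differences of three
    generic permuted points, respectively the cross-ratios of five
    ([ed_le_three], [ed_le_five]); A_4 is bounded by A_5. *)

Set Implicit Arguments.
Unset Strict Implicit.
Unset Printing Implicit Defensive.

Import GRing.Theory.

Local Open Scope classical_set_scope.
Local Open Scope ring_scope.

(** * Subfields of a field and relative algebraic closure *)

(** Bundling the closure properties turns a set of elements into a field type, to
    which the theory of algebraic elements over a field morphism applies. *)
Record divset (L : fieldType) := Divset {
  divset_carrier :> set L;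
  divset_closed : GRing.divring_closed (mem divset_carrier) }.

Definition divset_mem (L : fieldType) (F : divset L) : {pred L} :=
  [pred x | x \in (F : set L)].

HB.instance Definition _ (L : fieldType) (F : divset L) :=
  GRing.isDivringClosed.Build L (divset_mem F) (divset_closed F).

Record divset_type (L : fieldType) (F : divset L) := DivsetType {
  divset_val : L; _ : divset_val \in divset_mem F }.

HB.instance Definition _ (L : fieldType) (F : divset L) :=
  [isSub for @divset_val L F].
HB.instance Definition _ (L : fieldType) (F : divset L) :=
  [Choice of divset_type F by <:].
HB.instance Definition _ (L : fieldType) (F : divset L) :=
  [SubChoice_isSubIntegralDomain of divset_type F by <:].
HB.instance Definition _ (L : fieldType) (F : divset L) :=
  [SubIntegralDomain_isSubField of divset_type F by <:].

Lemma polyOver_setP (L : fieldType) (F : set L) (p : {poly L}) :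
  (p \is a polyOver (mem F)) <-> (forall i, (i < size p)%N -> F p`_i).
Proof.
by split=> [/allP pF i hi | h]; [apply/asboolP/pF/mem_nth |
  apply/allP=> c /(nthP 0)[i hi <-]; apply/asboolP/h].
Qed.

Lemma divset_algebraicP (L : fieldType) (F : divset L) (x : L) :
  algebraic_over F x <-> algebraicOver (\val : divset_type F -> L) x.
Proof.
split=> [[p [/polyOver_setP Fp p0 px]] | [q q0 qx]].
  have [q Eq] : exists q, map_poly (\val : divset_type F -> L) q = p.
    exists (\poly_(i < size p) insubd (0 : divset_type F) p`_i).
    apply/polyP=> i; rewrite coef_map coef_poly.
    case: ltnP => hi; first by rewrite /= insubdK //; apply/asboolP/Fp.
    by rewrite nth_default // (rmorph0 (\val : {rmorphism divset_type F -> L})).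
  exists q; rewrite ?Eq //.
  by apply: contra_neq p0 => q0; rewrite -Eq q0 rmorph0.
exists (map_poly (\val : divset_type F -> L) q); split=> //.
  by apply/polyOver_setP=> i _; rewrite coef_map; apply/asboolP; case: (q`_i).
by rewrite map_poly_eq0.
Qed.

Section Closure.
Variables (K L : fieldType) (iota : {rmorphism K -> L}).
Implicit Types (A B F : set L) (x y : L).

Section Subfield.
Variables (F : set L) (sF : subfield_over iota F).

Definition sdiv := Divset sF.2.

Let memE x : (x \in divset_mem sdiv) = `[< F x >]. Proof. by []. Qed.

Lemma sf_iota c : F (iota c).
Proof. by apply: sF.1; exists c. Qed.
Lemma sf_sum (I : Type) (r : seq I) (P : pred I) (f : I -> L) :
  (forall i, P i -> F (f i)) -> F (\sum_(i <- r | P i) f i).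
Proof.
move=> h; apply/asboolP; rewrite -memE; apply: rpred_sum => i Pi.
by rewrite memE; apply/asboolP/h.
Qed.
Lemma sf_prod (I : Type) (r : seq I) (P : pred I) (f : I -> L) :
  (forall i, P i -> F (f i)) -> F (\prod_(i <- r | P i) f i).
Proof.
move=> h; apply/asboolP; rewrite -memE; apply: rpred_prod => i Pi.
by rewrite memE; apply/asboolP/h.
Qed.
Lemma sf0 : F 0. Proof. by apply/asboolP; rewrite -memE rpred0. Qed.
Lemma sf1 : F 1. Proof. by apply/asboolP; rewrite -memE rpred1. Qed.
Lemma sfD x y : F x -> F y -> F (x + y).
Proof.
by move=> /asboolP Fx /asboolP Fy; apply/asboolP; rewrite -memE; apply: rpredD.
Qed.
Lemma sfM x y : F x -> F y -> F (x * y).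
Proof.
by move=> /asboolP Fx /asboolP Fy; apply/asboolP; rewrite -memE; apply: rpredM.
Qed.
Lemma sfN x : F x -> F (- x).
Proof. by move=> /asboolP Fx; apply/asboolP; rewrite -memE rpredN. Qed.
Lemma sfV x : F x -> F x^-1.
Proof. by move=> /asboolP Fx; apply/asboolP; rewrite -memE rpredV. Qed.
Lemma sfB x y : F x -> F y -> F (x - y).
Proof. by move=> ? ?; apply: sfD => //; apply: sfN. Qed.
Lemma sfX n x : F x -> F (x ^+ n).
Proof. by move=> ?; elim: n => [|n IH]; [exact: sf1 | rewrite exprS; apply: sfM]. Qed.
Lemma sf_mmap n (t : 'I_n -> L) (p : {mpoly K[n]}) :
  (forall i, F (t i)) -> F (mmap iota t p).
Proof.
move=> h; rewrite /mmap; apply: sf_sum => m _; apply: sfM; first exact: sf_iota.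
by apply: sf_prod => i _; apply: sfX.
Qed.
End Subfield.

Lemma subfieldP F : (forall c, F (iota c)) ->
  (forall x y, F x -> F y -> F (x - y)) ->
  (forall x y, F x -> F y -> F (x * y)) ->
  (forall x, F x -> F x^-1) -> subfield_over iota F.
Proof.
move=> h1 hB hM hV; split; first by move=> _ [c _ <-].
split=> [|x y /asboolP xF /asboolP yF|x y /asboolP xF /asboolP yF]; apply/asboolP.
- by rewrite -(rmorph1 iota).
- exact: hB.
- by apply: hM => //; apply: hV.
Qed.

Lemma subfield_gen A : subfield_over iota (field_gen iota A).
Proof.
apply: subfieldP => [c|x y xF yF|x y xF yF|x xF] F [sF sA].
- exact: sf_iota.
- by apply: (sfB sF); [apply: xF|apply: yF].
- by apply: (sfM sF); [apply: xF|apply: yF].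
- by apply: (sfV sF); apply: xF.
Qed.

Lemma sub_gen A : A `<=` field_gen iota A.
Proof. by move=> x Ax F [_]; apply. Qed.

Lemma gen_min A F : subfield_over iota F -> A `<=` F -> field_gen iota A `<=` F.
Proof. by move=> sF sA x; apply. Qed.

Lemma gen_mono A B : A `<=` B -> field_gen iota A `<=` field_gen iota B.
Proof.
move=> sAB; apply: gen_min; first exact: subfield_gen.
by apply: subset_trans sAB _; apply: sub_gen.
Qed.

(** The algebraic closure of K(A) in L, the closure operator of the matroid of
    algebraic dependence. *)
Definition cl A : set L := [set x | algebraic_over (field_gen iota A) x].

Lemma algebraic_base F (sF : subfield_over iota F) x : F x -> algebraic_over F x.
Proof.
move=> Fx; apply/(divset_algebraicP (sdiv sF)).
have Fx' : x \in divset_mem (sdiv sF) by apply/asboolP.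
exact: (algebraic_id (\val : divset_type (sdiv sF) -> L) (DivsetType Fx')).
Qed.

Lemma algebraic_mono A B x : A `<=` B -> algebraic_over A x -> algebraic_over B x.
Proof.
move=> sAB [p [pA p0 px]]; exists p; split=> //.
by move/polyOver_setP: pA => pA; apply/polyOver_setP => i /pA; apply: sAB.
Qed.

Lemma subfield_algebraic F (sF : subfield_over iota F) :
  subfield_over iota [set x | algebraic_over F x].
Proof.
have E := divset_algebraicP (sdiv sF).
apply: subfieldP => /= [c|x y /E ax /E ay|x y /E ax /E ay|x /E ax].
- by apply: algebraic_base => //; apply: sf_iota.
- by apply/E; apply: algebraic_sub.
- by apply/E; apply: algebraic_mul.
- by apply/E; apply: algebraic_inv.
Qed.

(** The coefficients of an equation for x are integral over F, hence so is x. *)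
Lemma algebraic_trans F (sF : subfield_over iota F) x :
  algebraic_over [set y | algebraic_over F y] x -> algebraic_over F x.
Proof.
move=> [p [/polyOver_setP pF p0 px]]; apply/(divset_algebraicP (sdiv sF)).
apply/integral_algebraic; apply: (integral_root p0 px) => c /(nthP 0)[i hi <-].
by apply/integral_algebraic/(divset_algebraicP (sdiv sF))/pF.
Qed.

Lemma subfield_cl A : subfield_over iota (cl A).
Proof. exact/subfield_algebraic/subfield_gen. Qed.

Lemma sub_cl A : A `<=` cl A.
Proof. by move=> x Ax; apply: algebraic_base; [exact: subfield_gen|exact: sub_gen]. Qed.

Lemma cl_sub A B : A `<=` cl B -> cl A `<=` cl B.
Proof.
move=> sAB x; rewrite /cl /= => ax; apply: (algebraic_trans (subfield_gen B)).
apply: algebraic_mono ax; apply: gen_min sAB; exact: subfield_cl.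
Qed.

Lemma cl_mono A B : A `<=` B -> cl A `<=` cl B.
Proof. by move=> sAB; apply: cl_sub; apply: subset_trans sAB _; apply: sub_cl. Qed.

End Closure.

(** * Transcendence bases *)

(** The universal property of polynomial rings: most identities between
    substitutions below are checked on constants and variables. *)
Lemma mpoly_morph_ext (K : fieldType) n (S : comNzRingType)
    (f g : {rmorphism {mpoly K[n]} -> S}) :
  (forall c, f c%:MP = g c%:MP) -> (forall i, f 'X_i = g 'X_i) -> f =1 g.
Proof.
move=> hC hX p; rewrite [p]mpolyE !rmorph_sum; apply: eq_bigr => m _.
rewrite -mul_mpolyC mpolyXE_id !rmorphM hC !rmorph_prod; congr (_ * _).
by apply: eq_bigr => i _; rewrite !rmorphXn hX.
Qed.

Section LastVariable.
Variables (K : fieldType) (n : nat).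

Definition widen1 (i : 'I_n) : 'I_n.+1 := widen_ord (leqnSn n) i.

Lemma ord_widen_or_max (i : 'I_n.+1) : (exists j, i = widen1 j) \/ i = ord_max.
Proof.
case: (unliftP ord_max i) => [j -> | ->]; [left | by right].
by exists j; apply/val_inj; rewrite /= /bump leqNgt ltn_ord.
Qed.

Lemma muni_widen (i : 'I_n) : muni ('X_(widen1 i) : {mpoly K[n.+1]}) = ('X_i)%:P.
Proof.
rewrite /muni mmapX mmap1U.
case: splitP=> [j eq|j]; first by congr ('X__)%:P; apply/val_inj=> /=; rewrite -eq.
by rewrite ord1 /= addn0 => /eqP /=; rewrite ltn_eqF.
Qed.

Lemma muni_max : muni ('X_ord_max : {mpoly K[n.+1]}) = 'X.
Proof.
rewrite /muni mmapX mmap1U.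
case: splitP=> //; case=> j lt_jn /eqP /=.
by have := lt_jn; rewrite ltn_neqAle eq_sym=> /andP[/negbTE->].
Qed.

(** The inverse of [muni], so that a polynomial in n + 1 variables is the same as
    a univariate one over the ring in the first n variables. *)
Definition munlift (P : {poly {mpoly K[n]}}) : {mpoly K[n.+1]} :=
  (map_poly (@mwiden n K) P).['X_ord_max].

Lemma muni_mwiden (c : {mpoly K[n]}) : muni (mwiden c) = c%:P.
Proof.
apply: (@mpoly_morph_ext _ _ _ (@muni n K \o @mwiden n K) polyC) => [x|i] /=.
  by rewrite mwidenC muniC.
by rewrite mwidenX mnmwiden1 muni_widen.
Qed.

Lemma munliftK : cancel munlift (@muni n K).
Proof.
move=> P; rewrite /munlift -(horner_map (@muni n K)) /= muni_max -map_poly_comp.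
rewrite (eq_map_poly (g := polyC)) => [|c]; last exact: muni_mwiden.
by rewrite -/(comp_poly _ _) comp_polyXr.
Qed.

Lemma muniK : cancel (@muni n K) munlift.
Proof.
pose f : {rmorphism {poly {mpoly K[n]}} -> {mpoly K[n.+1]}} :=
  horner_eval ('X_ord_max : {mpoly K[n.+1]}) \o map_poly (@mwiden n K).
apply: (@mpoly_morph_ext _ _ _ (f \o @muni n K) idfun) => [x|i] /=.
  by rewrite muniC /= /horner_eval map_polyC hornerC /= mwidenC.
rewrite /horner_eval; case: (ord_widen_or_max i) => [[j ->]|->].
  by rewrite muni_widen map_polyC hornerC /= mwidenX mnmwiden1.
by rewrite muni_max map_polyX hornerX.
Qed.

(** Evaluation can be done one variable at a time; this drives all inductions on
    the number of variables. *)
Lemma mmap_muni (L : fieldType) (iota : {rmorphism K -> L}) (t : 'I_n.+1 -> L) p :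
  mmap iota t p = (map_poly (mmap iota (t \o widen1)) (muni p)).[t ord_max].
Proof.
pose f : {rmorphism {poly {mpoly K[n]}} -> L} :=
  horner_eval (t ord_max) \o map_poly (mmap iota (t \o widen1)).
apply: (@mpoly_morph_ext _ _ _ (mmap iota t) (f \o @muni n K)) => [x|i] /=.
  by rewrite muniC /= /horner_eval map_polyC hornerC /= !mmapC.
rewrite mmapX mmap1U /horner_eval; case: (ord_widen_or_max i) => [[j ->]|->].
  by rewrite muni_widen map_polyC hornerC /= mmapX mmap1U.
by rewrite muni_max map_polyX hornerX.
Qed.

End LastVariable.

Lemma clear_denominators (D : comNzRingType) (L : fieldType)
    (phi : {rmorphism D -> L}) (P : {poly L}) :
  (forall i, exists a b, phi b != 0 /\ P`_i = phi a / phi b) ->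
  exists (R : {poly D}) (b : D), phi b != 0 /\ map_poly phi R = phi b *: P.
Proof.
elim/poly_ind: P => [_|P c IH h].
  by exists 0, 1; rewrite rmorph1 oner_neq0 rmorph0 scaler0.
have [i|R [b [b0 hR]]] := IH.
  by have := h i.+1; rewrite coefD coefMX coefC /= addr0.
have [a [d [d0 hc]]] := h 0%N; rewrite coefD coefMX coefC /= add0r in hc.
exists (d *: R * 'X + (a * b)%:P), (b * d).
rewrite rmorphM mulf_neq0 //; split=> //.
rewrite rmorphD rmorphM /= map_polyX map_polyC map_polyZ hR /= rmorphM hc.
rewrite scalerDr scalerAl !scalerA [phi d * _]mulrC -!mul_polyC -!polyCM.
suff -> : phi a * phi b = phi b * phi d * (phi a / phi d) by [].
by field.
Qed.

Section EvalPoly.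
Variables (S : nzRingType) (L : comNzRingType) (j : {rmorphism S -> L}) (z : L).

Definition evalp : {rmorphism {poly S} -> L} := horner_eval z \o map_poly j.

Lemma evalpE p : evalp p = (map_poly j p).[z].
Proof. by []. Qed.

End EvalPoly.

Section Exchange.
Variables (K L : fieldType) (iota : {rmorphism K -> L}).
Implicit Types (A B F : set L) (x y : L).
Notation cl := (cl iota).
Notation gen := (field_gen iota).

Lemma gen_fractions (D : comNzRingType) (phi : {rmorphism D -> L}) A x :
  (forall c, exists d, iota c = phi d) -> (forall x, A x -> exists d, x = phi d) ->
  gen A x -> exists a b, phi b != 0 /\ x = phi a / phi b.
Proof.
move=> hK hA.
apply: (@gen_min _ _ iota A [set x | exists a b, phi b != 0 /\ x = phi a / phi b]);
  last first.
  by move=> y /hA [a ->]; exists a, 1; rewrite rmorph1 oner_neq0 divr1.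
apply: subfieldP => [c|u v|u v|u].
- by have [a ->] := hK c; exists a, 1; rewrite rmorph1 oner_neq0 divr1.
- move=> [a [b [b0 ->]]] [c [d [d0 ->]]]; exists (a * d - c * b), (b * d).
  by rewrite rmorphB !rmorphM mulf_neq0 //; split=> //; field; rewrite b0 d0.
- move=> [a [b [b0 ->]]] [c [d [d0 ->]]]; exists (a * c), (b * d).
  by rewrite !rmorphM mulf_neq0 //; split=> //; field; rewrite b0 d0.
- move=> [a [b [b0 ->]]]; have [a0|a0] := eqVneq (phi a) 0.
    by exists 0, 1; rewrite rmorph0 rmorph1 oner_neq0 a0 !mul0r invr0.
  by exists b, a; rewrite a0 invf_div.
Qed.

(** Algebraicity over a field of fractions only needs an equation with
    coefficients in a ring of which A consists of values. *)
Lemma algebraic_clear (D : comNzRingType) (phi : {rmorphism D -> L}) A x :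
  (forall c, exists d, iota c = phi d) -> (forall x, A x -> exists d, x = phi d) ->
  cl A x -> exists R : {poly D}, map_poly phi R != 0 /\ root (map_poly phi R) x.
Proof.
move=> hK hA [P [/polyOver_setP PA P0 Px]].
have [i|R [b [b0 hR]]] := @clear_denominators D L phi P.
  have [/PA|hi] := ltnP i (size P); first exact: gen_fractions.
  by exists 0, 1; rewrite rmorph1 oner_neq0 nth_default // rmorph0 mul0r.
by exists R; rewrite hR scaler_eq0 negb_or b0 P0 rootZ.
Qed.

Lemma subfield_morph F : subfield_over iota F ->
  exists (S : fieldType) (j : {rmorphism S -> L}),
    (forall d, F (j d)) /\ (forall z, F z -> exists d, z = j d).
Proof.
move=> sF; exists (divset_type (sdiv sF)), \val; split=> [[d /asboolP]|z Fz] //.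
have Fz' : z \in divset_mem (sdiv sF) by apply/asboolP.
by exists (DivsetType Fz').
Qed.

(** An equation of x over K(A)(y) clears to a polynomial in two variables over
    K(A) that vanishes at (x, y). Read as an equation for y over K(A)(x) it stays
    nontrivial, since otherwise some nonzero polynomial over K(A) would kill x. *)
Lemma cl_exchange A x y : cl (A `|` [set y]) x -> ~ cl A x -> cl (A `|` [set x]) y.
Proof.
move=> xAy nxA.
have [S [j [jF jP]]] := subfield_morph (subfield_gen iota A).
pose ev z := evalp j z.
have evC z d : ev z d%:P = j d by rewrite evalpE map_polyC hornerC.
have [c|z|R [R0 Rx]] := @algebraic_clear _ (ev y) (A `|` [set y]) x _ _ xAy.
- have [d ->] := jP (iota c) (sf_iota (subfield_gen iota A) c).
  by exists d%:P; rewrite evC.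
- case=> [Az|->]; last by exists 'X; rewrite evalpE map_polyX hornerX.
  have [d ->] : exists d, z = j d by apply: jP; apply: sub_gen.
  by exists d%:P; rewrite evC.
have E u v (T : {poly {poly S}}) :
    (map_poly (ev u) T).[v] = (map_poly (map_poly j) T).[v%:P].[u].
  have := horner_map (horner_eval u) (map_poly (map_poly j) T) v%:P.
  rewrite -map_poly_comp /= /horner_eval hornerC => <-.
  by congr (horner _ _); apply: eq_map_poly.
(* the same polynomial in two variables, now read as an equation for y *)
pose Q := map_poly (ev x) (swapXY R).
have sA : gen A `<=` gen (A `|` [set x]) by apply: gen_mono => z; left.
exists Q; split.
- apply/polyOver_setP => i _; rewrite coef_map.
  rewrite -[X in gen _ X]/((map_poly j (swapXY R)`_i).[x]) horner_coef.
  have sF := subfield_gen iota (A `|` [set x]).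
  apply: (sf_sum sF) => k _; apply: (sfM sF); first by rewrite coef_map; apply: sA; apply: jF.
  by apply: (sfX sF); apply: sub_gen; right.
- apply/eqP => Q0; move: R0; rewrite -(swapXYK R).
  suff -> : swapXY R = 0 by rewrite !rmorph0 eqxx.
  apply/polyP=> k; rewrite coef0; have := congr1 (fun p : {poly L} => p`_k) Q0.
  rewrite coef_map coef0 -[X in X = 0]/((map_poly j (swapXY R)`_k).[x]) => rk; apply: contra_not_eq nxA => ck.
  exists (map_poly j (swapXY R)`_k); split.
  + by apply/polyOver_setP => i _; rewrite coef_map; apply: jF.
  + by rewrite map_poly_eq0.
  + by rewrite /root rk.
- by move: Rx; rewrite /root !E -swapXY_map horner2_swapXY.
Qed.

(** Each entry of s is transcendental over r and the earlier entries. The base r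
    varies so that the exchange argument is an induction on s. *)
Fixpoint indep (r s : seq L) : Prop :=
  if s is x :: s' then ~ cl [set` r] x /\ indep (x :: r) s' else True.

(** The head x of s lies in the closure of t and r but not of r alone. Dropping
    entries from the front of t, there is a first y whose removal loses x, and by
    exchange x can replace y. *)
Lemma steinitz s r t : indep r s -> [set` s] `<=` cl [set` t ++ r] ->
  (size s <= size t)%N.
Proof.
elim: s r t => [//|x s IH] r t /= [nx is_] sc.
have xc : cl [set` t ++ r] x by apply: sc; rewrite /= inE eqxx.
have [t1 [y [t2 [Et yc]]]] : exists t1 y t2, t = t1 ++ y :: t2 /\
    cl [set` (x :: t2) ++ r] y.
  elim: t {IH is_ sc} xc => [|y t IH xc]; first by [].
  have [/IH[t1 [z [t2 [-> hz]]]]|nxt] := pselect (cl [set` t ++ r] x).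
    by exists (y :: t1), z, t2.
  exists [::], y, t; split=> //.
  have := @cl_exchange [set` t ++ r] x y.
  have E z : [set` t ++ r] `|` [set z] = [set` (z :: t) ++ r].
    by apply/seteqP; split=> w /=; rewrite !inE; [case=> [->|->]; rewrite ?eqxx ?orbT|
       case/orP=> [/eqP ->|]; [right|left]].
  by rewrite !E; apply.
rewrite Et size_cat /= addnS ltnS -size_cat; apply: IH is_ _.
have xin : x \in (t1 ++ t2) ++ x :: r by rewrite mem_cat inE eqxx orbT.
apply: subset_trans (_ : cl [set` t ++ r] `<=` _).
  by apply: subset_trans sc => w /= ws; rewrite inE ws orbT.
apply: cl_sub => w /=; rewrite Et !(inE, mem_cat).
have [/eqP -> _ |nwy] := boolP (w == y).
  apply: cl_mono yc => u /=; rewrite !(inE, mem_cat).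
  by case: (u == x); case: (u \in t1); case: (u \in t2); case: (u \in r).
move=> h; apply: sub_cl; move: h; rewrite /= !(inE, mem_cat).
by case: (w == x); case: (w \in t1); case: (w \in t2); case: (w \in r).
Qed.

Lemma cl_mmap n (t : 'I_n -> L) (P : {poly {mpoly K[n]}}) x :
  map_poly (mmap iota t) P != 0 -> root (map_poly (mmap iota t) P) x ->
  cl (range t) x.
Proof.
move=> P0 Px; exists (map_poly (mmap iota t) P); split=> //.
apply/polyOver_setP=> i _; rewrite coef_map.
by apply: sf_mmap => [|k]; [exact: subfield_gen|apply: sub_gen; exists k].
Qed.

Lemma cl_mmapP n (t : 'I_n -> L) x : cl (range t) x ->
  exists P : {poly {mpoly K[n]}},
    map_poly (mmap iota t) P != 0 /\ root (map_poly (mmap iota t) P) x.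
Proof.
apply: algebraic_clear => [c|y [i _ <-]].
  by exists c%:MP; rewrite /= mmapC.
by exists 'X_i; rewrite /= mmapX mmap1U.
Qed.

Lemma range_widen1 n (t : 'I_n.+1 -> L) :
  range t = range (t \o @widen1 n) `|` [set t ord_max].
Proof.
apply/seteqP; split=> x.
  by move=> [i _ <-]; case: (ord_widen_or_max i) => [[j ->]|->]; [left; exists j|right].
by move=> [[j _ <-]|->]; [exists (widen1 j)|exists ord_max].
Qed.

(** Algebraic independence can be tested one element at a time, which links the
    definition by polynomials to the closure operator. *)
Lemma alg_independentS n (t : 'I_n.+1 -> L) : alg_independent iota t <->
  alg_independent iota (t \o @widen1 n) /\ ~ cl (range (t \o @widen1 n)) (t ord_max).
Proof.
split=> [it|[it nt] p].
  split=> [p p0|/cl_mmapP[P [P0]]].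
    have : munlift p%:P = 0 :> {mpoly K[n.+1]}.
      by apply: it; rewrite mmap_muni munliftK map_polyC hornerC /= p0.
    move/(congr1 (@muni n K)); rewrite munliftK raddf0 => /eqP.
    by rewrite polyC_eq0 => /eqP.
  move=> Pt; have : munlift P = 0 by apply: it; rewrite mmap_muni munliftK; apply/eqP.
  move/(congr1 (@muni n K)); rewrite munliftK raddf0 => P00.
  by rewrite P00 rmorph0 eqxx in P0.
rewrite mmap_muni => pt.
have [P0|P0] := eqVneq (map_poly (mmap iota (t \o @widen1 n)) (muni p)) 0.
  rewrite -(muniK p); suff -> : muni p = 0 by rewrite /munlift rmorph0 horner0.
  apply/polyP=> i; rewrite coef0; apply: it.
  by have := congr1 (fun q : {poly L} => q`_i) P0; rewrite coef_map coef0.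
by case: nt; apply: cl_mmap P0 _; apply/eqP.
Qed.

Lemma alg_independent0 (t : 'I_0 -> L) : alg_independent iota t.
Proof.
move=> p; rewrite (_ : p = (p@_0%MM)%:MP).
  by rewrite mmapC => /eqP; rewrite fmorph_eq0 => /eqP ->; rewrite mpolyC0.
apply/mpolyP=> m; rewrite mcoeffC.
have -> : m = 0%MM by apply/mnmP; case.
by rewrite eqxx mulr1.
Qed.

Lemma indep_rcons r s x :
  indep r s -> ~ cl ([set` s] `|` [set` r]) x -> indep r (rcons s x).
Proof.
elim: s r => [|y s IH] r /=.
  by move=> _ nx; split=> //; apply: contra_not nx; apply: cl_mono => z; right.
move=> [ny is_] nx; split=> //; apply: IH => //; apply: contra_not nx.
apply: cl_mono => z; rewrite /= !inE => -[->|/orP[->|rz]];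
  by [left; rewrite ?orbT | right].
Qed.

Lemma alg_independent_indep n (t : 'I_n -> L) : alg_independent iota t ->
  exists s, [/\ size s = n, [set` s] = range t & indep [::] s].
Proof.
elim: n t => [|n IH] t.
  by exists [::]; split=> //; apply/seteqP; split=> // x [[]].
move=> /alg_independentS[/IH[s [ss sr is_]] nt].
exists (rcons s (t ord_max)); split; first by rewrite size_rcons ss.
  rewrite range_widen1 -sr; apply/seteqP.
  split=> x; rewrite /= mem_rcons inE.
    by case/orP=> [/eqP ->|]; [right|left].
  by case=> [->|->]; rewrite ?eqxx ?orbT.
apply: indep_rcons => //; rewrite sr; apply: contra_not nt.
by apply: cl_mono => z [].
Qed.

Lemma trdeg_le m d (y : 'I_m -> L) (t : 'I_d -> L) :
  alg_independent iota y -> range y `<=` cl (range t) -> (m <= d)%N.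
Proof.
move=> /alg_independent_indep[s [ss sr is_]] yt; rewrite -ss.
pose tt := [seq t i | i <- enum 'I_d].
have -> : d = size tt by rewrite size_map size_enum_ord.
apply: steinitz is_ _; rewrite sr cats0; apply: subset_trans yt _.
by apply: cl_mono => x [i _ <-]; apply/mapP; exists i; rewrite ?mem_enum.
Qed.

Definition extend n (u : 'I_n -> L) (x : L) (i : 'I_n.+1) : L :=
  if unlift ord_max i is Some j then u j else x.

Lemma extend_widen n (u : 'I_n -> L) x : extend u x \o @widen1 n = u.
Proof.
apply/funext => i; rewrite /extend /=.
have -> : widen1 i = lift ord_max i.
  by apply/val_inj; rewrite /= /bump leqNgt ltn_ord.
by rewrite liftK.
Qed.

Lemma extend_max n (u : 'I_n -> L) x : extend u x ord_max = x.
Proof. by rewrite /extend unlift_none. Qed.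

(** An independent family in E of maximal size is a transcendence basis, since any
    element outside its closure would extend it. *)
Lemma exists_maximal_independent (E : set L) d :
  (forall e (u : 'I_e -> L), (forall i, E (u i)) -> alg_independent iota u -> (e <= d)%N) ->
  exists e (u : 'I_e -> L),
    [/\ (e <= d)%N, forall i, E (u i), alg_independent iota u & E `<=` cl (range u)].
Proof.
move=> Ed.
pose P e := `[< exists u : 'I_e -> L, (forall i, E (u i)) /\ alg_independent iota u >].
have bP e : P e -> (e <= d)%N.
  by move=> /asboolP[u [uE iu]]; apply: Ed iu.
have exP : exists e, P e.
  exists 0%N; apply/asboolP; exists (fun i : 'I_0 => 0); split; first by case.
  exact: alg_independent0.
case: (ex_maxnP exP bP) => e Pe maxe; have := Pe.
move=> /asboolP[u [uE iu]]; exists e, u; split=> // [|x Ex]; first exact: bP.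
apply: contrapT => nx.
suff /maxe : P e.+1 by rewrite ltnn.
apply/asboolP; exists (extend u x); split=> [i|].
  by rewrite /extend; case: unliftP.
by apply/alg_independentS; rewrite extend_widen extend_max.
Qed.

End Exchange.

(** * Finite group actions and compressions *)

Record field_action (gT : finGroupType) (K L : fieldType)
    (iota : {rmorphism K -> L}) := FieldAction {
  act :> gT -> {rmorphism L -> L};
  actM : forall g h x, act (g * h)%g x = act g (act h x);
  act_iota : forall g c, act g (iota c) = iota c }.

Section Actions.
Variables (gT : finGroupType) (K L : fieldType) (iota : {rmorphism K -> L}).
Variable a : field_action gT iota.
Implicit Types (F E : set L) (g h : gT) (x y : L).
Notation cl := (cl iota).
Notation gen := (field_gen iota).

Lemma act1 x : a 1%g x = x.
Proof. by apply: (fmorph_inj (a 1%g)); rewrite -actM mulg1. Qed.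

Definition fixed : set L := [set x | forall g, a g x = x].
Definition stable F := forall g x, F x -> F (a g x).
(** Relative to the kernel of the action on L: this also makes sense when the
    action on L is not faithful, as happens for residue fields. *)
Definition detects F := forall g, (exists x, a g x != x) -> exists2 x, F x & a g x != x.
Definition faithful := forall g, g != 1%g -> exists x, a g x != x.

(** The finite data of a compression to transcendence degree at most d: the
    subfield generated by s is stable, has the same kernel of action as L, and is
    algebraic over d elements. The elements of t need not lie in that subfield. *)
Definition compressible d := exists (s : seq L) (t : 'I_d -> L),
  [/\ stable [set` s], detects [set` s] & [set` s] `<=` cl (range t)].

Lemma compressible_of_stable F d (t : 'I_d -> L) :
  F 0 -> stable F -> detects F -> F `<=` cl (range t) -> compressible d.
Proof.
move=> F0 sF dF Ft.
pose u g := xget 0 [set x | F x /\ a g x != x].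
have Fu g : F (u g) by rewrite /u; case: xgetP => // y -> [].
pose s := [seq a h (u g) | h <- enum gT, g <- enum gT].
exists s, t; split.
- move=> g x /allpairsP[[h k] [_ _ ->]]; apply/allpairsP; exists ((g * h)%g, k) => /=.
  by rewrite !mem_enum actM.
- move=> g /dF[x Fx gx]; exists (u g).
    by apply/allpairsP; exists (1%g, g); rewrite /= !mem_enum act1.
  rewrite /u; case: xgetP => [y -> []//|/(_ x)].
  by case.
- by move=> _ /allpairsP[[h k] [_ _ ->]]; apply/Ft/sF/Fu.
Qed.

Lemma compressible_le d e : (d <= e)%N -> compressible d -> compressible e.
Proof.
move=> de [s [t [h1 h2 h3]]].
exists s, (fun i : 'I_e => if insub (val i) is Some j then t j else 0); split=> //.
apply: subset_trans h3 _; apply: cl_mono => x [i _ <-].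
by exists (widen_ord de i) => //; rewrite -[insub _]/(insub (val i)) valK.
Qed.

Section Artin.
Variables (F : set L) (sF : subfield_over iota F) (stF : stable F).
Hypothesis fF : forall g, g != 1%g -> exists2 x, F x & a g x != x.

(** The functions on the group obtained from F tensor F by acting on the second
    factor. The proof of Artin's theorem consists in finding the delta function at
    the identity among them. *)
Definition pairing (s : seq (L * L)) g := \sum_(p <- s) p.1 * a g p.2.
Definition in_pairing (f : gT -> L) :=
  exists s : seq (L * L), (forall p, p \in s -> F p.1 /\ F p.2) /\ f =1 pairing s.

Lemma in_pairingM f1 f2 :
  in_pairing f1 -> in_pairing f2 -> in_pairing (fun g => f1 g * f2 g).
Proof.
move=> [s1 [F1 E1]] [s2 [F2 E2]].
exists [seq (p.1 * q.1, p.2 * q.2) | p <- s1, q <- s2]; split.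
  move=> _ /allpairsP[[p q] [/= /F1[? ?] /F2[? ?] ->]] /=.
  by split; apply: (sfM sF).
move=> g; rewrite E1 E2 /pairing big_allpairs_dep mulr_suml; apply: eq_bigr => p _.
by rewrite mulr_sumr; apply: eq_bigr => q _; rewrite /= rmorphM /= mulrACA.
Qed.

(** For h <> 1 pick u in F moved by h. The function
    g |-> (g u - h u) / (u - h u) is 1 at the identity and 0 at h, so the product
    over all h <> 1 is the delta function. *)
Lemma in_pairing_delta : in_pairing (fun g => (g == 1%g)%:R).
Proof.
pose u h := xget 0 [set x | F x /\ a h x != x].
have Fu h : F (u h) by rewrite /u; case: xgetP => [y -> []//|_]; apply: sf0 sF.
have nu h : h != 1%g -> u h - a h (u h) != 0.
  move=> /fF[x Fx hx]; rewrite subr_eq0 eq_sym /u.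
  by case: xgetP => [y -> []//|/(_ x)]; case.
pose f h g := (a g (u h) - a h (u h)) / (u h - a h (u h)).
have f_in h : in_pairing (f h).
  pose c := (u h - a h (u h))^-1.
  have Fc : F c by apply/(sfV sF)/(sfB sF) => //; apply: stF.
  exists [:: (c, u h); (- c * a h (u h), 1)]; split.
    move=> p; rewrite !inE => /orP[]/eqP -> /=; split=> //; last exact: sf1 sF.
    by apply: (sfM sF); [apply: (sfN sF)|apply: stF].
  by move=> g; rewrite /pairing !big_cons big_nil /= rmorph1 /f -/c; ring.
have prod_in (r : seq gT) : in_pairing (fun g => \prod_(h <- r) f h g).
  elim: r => [|h r IH].
    exists [:: (1, 1)]; split.
      by move=> p; rewrite inE => /eqP ->; split; apply: sf1 sF.
    by move=> g; rewrite /pairing big_nil big_seq1 /= rmorph1 mulr1.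
  have [s [s1 s2]] := in_pairingM (f_in h) IH; exists s; split=> // g.
  by rewrite big_cons s2.
have [s [s1 s2]] := prod_in [seq h <- enum gT | h != 1%g].
exists s; split=> // g; rewrite -s2 big_filter.
have [->|g1] := eqVneq g 1%g.
  rewrite big1 // => h h1; rewrite /f act1 divff //; exact: nu.
by rewrite big_enum_cond /= (bigD1 g) //= {1}/f subrr !mul0r.
Qed.

Definition dual_family m (lam b : 'I_m -> L) :=
  [/\ forall i, F (lam i), forall i, F (b i) &
      forall g, \sum_i lam i * a g (b i) = (g == 1%g)%:R].

Lemma exists_dual_family : exists m (lam b : 'I_m -> L), dual_family lam b.
Proof.
have [s [s1 s2]] := in_pairing_delta.
exists (size s), (fun i => (tnth (in_tuple s) i).1), (fun i => (tnth (in_tuple s) i).2).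
have sin i := s1 _ (mem_tnth i (in_tuple s)).
split=> [i|i|g]; try by case: (sin i).
by have /= -> := s2 g; rewrite /pairing [RHS]big_tnth.
Qed.

(** In a dual family of minimal length, lam is linearly independent over F^G: a
    dependent lam k could be eliminated by modifying the b's. *)
Lemma exists_dual_basis : exists m (lam b : 'I_m -> L), dual_family lam b /\
  forall c : 'I_m -> L, (forall i, F (c i) /\ fixed (c i)) ->
    \sum_i c i * lam i = 0 -> forall i, c i = 0.
Proof.
pose P m := `[< exists lam b : 'I_m -> L, dual_family lam b >].
have exP : exists m, P m.
  by have [m [lam [b h]]] := exists_dual_family; exists m; apply/asboolP; exists lam, b.
case: (ex_minnP exP) => m /asboolP[lam [b [lF bF lb]]] mmin.
exists m, lam, b; split=> // c cF c0 k; apply/eqP/negPn/negP => ck.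
case: m lam b lF bF lb mmin c cF c0 k ck => [|m] lam b lF bF lb mmin c cF c0 k ck.
  by case: k ck.
suff /mmin : P m by rewrite ltnn.
pose e i := - (c i / c k).
have eF i : F (e i).
  by apply/(sfN sF)/(sfM sF); [case: (cF i)|apply: (sfV sF); case: (cF k)].
have eG i g : a g (e i) = e i.
  by rewrite rmorphN fmorph_div; case: (cF i) => _ ->; case: (cF k) => _ ->.
(* the relation solved for lam k, with coefficients in F^G *)
have lk : lam k = \sum_(j < m) e (lift k j) * lam (lift k j).
  apply: (mulfI ck); move: c0; rewrite (bigD1_ord k) //= => /eqP.
  rewrite addr_eq0 => /eqP ->; rewrite -sumrN mulr_sumr.
  by apply: eq_bigr => j _; rewrite /e; field.
apply/asboolP; exists (lam \o lift k), (fun j => b (lift k j) + e (lift k j) * b k).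
split=> [j|j|g] /=; first exact: lF.
  by apply: (sfD sF) => //; apply: (sfM sF).
rewrite -lb (bigD1_ord k) //= lk mulr_suml -big_split /=; apply: eq_bigr => j _.
by rewrite rmorphD rmorphM /= eG; ring.
Qed.

(** Artin's theorem. Expanding x = \sum_g delta(g) g x gives the coordinates
    Tr (b_i x) of x in the family lam. Over F^G independence forces
    Tr (b_j lam_k) = delta_jk, and this orthogonality gives uniqueness of the
    coordinates in every larger stable field E, with the same m. *)
Lemma dual_degree m (lam b : 'I_m -> L) (E : set L) :
  dual_family lam b ->
  (forall c : 'I_m -> L, (forall i, F (c i) /\ fixed (c i)) ->
    \sum_i c i * lam i = 0 -> forall i, c i = 0) ->
  subfield_over iota E -> stable E -> F `<=` E ->
  is_degree E (E `&` fixed) m.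
Proof.
move=> [lF bF lb] li sE stE FE.
pose Tr x := \sum_g a g x.
have TrG x : fixed (Tr x).
  move=> g; rewrite /Tr rmorph_sum [RHS](reindex_inj (mulgI g)) /=.
  by apply: eq_bigr => h _; rewrite actM.
have TrE (M : set L) : subfield_over iota M -> stable M -> forall x, M x -> M (Tr x).
  by move=> sM stM x Mx; apply: (sf_sum sM) => g _; apply: stM.
have expand x : x = \sum_i Tr (b i * x) * lam i.
  transitivity (\sum_g a g x * \sum_i lam i * a g (b i)).
    rewrite (bigD1 1%g) //= lb eqxx act1 mulr1 big1 ?addr0 // => g g1.
    by rewrite lb (negbTE g1) mulr0.
  under eq_bigr do rewrite mulr_sumr; rewrite exchange_big; apply: eq_bigr => i _.
  by rewrite mulr_suml; apply: eq_bigr => g _; rewrite rmorphM /=; ring.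
have orth j k : Tr (b j * lam k) = (j == k)%:R.
  have := li (fun j => Tr (b j * lam k) - (j == k)%:R).
  move=> H; apply/eqP; rewrite -subr_eq0; apply/eqP; apply: H => [i|].
    split.
      apply: (sfB sF); first by apply: TrE => //; apply: (sfM sF).
      by case: (i == k); [exact: sf1 sF|exact: sf0 sF].
    by move=> g; rewrite rmorphB rmorph_nat TrG.
  under eq_bigr do rewrite mulrBl.
  rewrite sumrB -expand [X in _ - X](bigD1 k) //= eqxx mul1r big1 ?addr0 ?subrr //.
  by move=> i /negbTE ->; rewrite mul0r.
exists lam => [i|x Ex]; first exact: FE.
exists [ffun i => Tr (b i * x)]; split.
  split=> [i|]; first rewrite ffunE.
    by split=> //; apply: TrE => //; apply: (sfM sE) => //; apply: FE.
  by under eq_bigr do rewrite ffunE; exact: expand.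
move=> c [cE xE]; apply/ffunP=> j; rewrite ffunE xE mulr_sumr /Tr.
under eq_bigr do rewrite rmorph_sum; rewrite exchange_big /= (bigD1 j) //=.
have E1 i : \sum_g a g (b j * (c i * lam i)) = c i * Tr (b j * lam i).
  rewrite /Tr mulr_sumr; apply: eq_bigr => g _.
  by rewrite !rmorphM /=; case: (cE i) => _ ->; rewrite mulrCA.
rewrite E1 orth eqxx mulr1 big1 ?addr0 // => i /negbTE ij.
by rewrite E1 orth eq_sym ij mulr0.
Qed.

End Artin.

Definition ed_candidate E0 :=
  [/\ subfield_over iota E0, E0 `<=` fixed & defined_over iota fixed E0].

Lemma subfield_fixed : subfield_over iota fixed.
Proof.
apply: subfieldP => [c g|x y hx hy g|x y hx hy g|x hx g]; first exact: act_iota.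
- by rewrite rmorphB hx hy.
- by rewrite rmorphM /= hx hy.
- by rewrite fmorphV hx.
Qed.

(** The dual basis of F over F^G is also a basis of L over L^G, so the extension
    L / L^G is defined over F^G. *)
Lemma candidate_of_stable F : faithful -> subfield_over iota F -> stable F ->
  detects F -> ed_candidate (F `&` fixed).
Proof.
move=> fa sF stF dF.
have fF g : g != 1%g -> exists2 x, F x & a g x != x by move=> /fa/dF.
have [m [lam [b [df li]]]] := exists_dual_basis sF stF fF.
have sFf : subfield_over iota (F `&` fixed).
  have sG := subfield_fixed.
  apply: subfieldP => [c|x y [? ?] [? ?]|x y [? ?] [? ?]|x [? ?]].
  - by split; [apply: (sf_iota sF)|apply: (sf_iota sG)].
  - by split; [apply: (sfB sF)|apply: (sfB sG)].
  - by split; [apply: (sfM sF)|apply: (sfM sG)].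
  - by split; [apply: (sfV sF)|apply: (sfV sG)].
have sT : subfield_over iota [set: L] by apply: subfieldP.
split=> //.
have dL := dual_degree sF stF df li sT (fun _ _ _ => I) (fun _ _ => I).
rewrite setTI in dL.
exists F; split=> //.
  by exists m => //; apply: (dual_degree sF stF df li).
apply/seteqP; split=> // x _.
case: df => lF bF lb.
have -> : x = \sum_g a g x * \sum_i lam i * a g (b i).
  rewrite (bigD1 1%g) //= lb eqxx act1 mulr1 big1 ?addr0 // => g g1.
  by rewrite lb (negbTE g1) mulr0.
under eq_bigr do rewrite mulr_sumr; rewrite exchange_big /=.
have sgn := subfield_gen iota (F `|` fixed).
apply: (sf_sum sgn) => i _.
rewrite (_ : \sum_j _ = lam i * \sum_g a g (b i * x)); last first.
  by rewrite mulr_sumr; apply: eq_bigr => g _; rewrite rmorphM /=; ring.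
apply: (sfM sgn); first by apply: sub_gen; left; apply: lF.
apply: sub_gen; right=> g; rewrite rmorph_sum [RHS](reindex_inj (mulgI g)) /=.
by apply: eq_bigr => h _; rewrite actM.
Qed.

Lemma stable_gen (A : set L) : stable A -> stable (gen A).
Proof.
move=> st g; have sF := subfield_gen iota A.
apply: (gen_min (F := [set x | gen A (a g x)])).
  apply: subfieldP => [c|x y|x y|x] /=.
  - by rewrite act_iota; apply: (sf_iota sF).
  - by rewrite rmorphB; apply: (sfB sF).
  - by rewrite rmorphM; apply: (sfM sF).
  - by rewrite fmorphV; apply: (sfV sF).
by move=> x sx; apply: sub_gen; apply: st.
Qed.

Lemma trdeg_of_compressible d : faithful -> compressible d ->
  exists e E0, [/\ (e <= d)%N, ed_candidate E0 & is_trdeg iota E0 e].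
Proof.
move=> fa [s [t [st dt tt]]].
have sF := subfield_gen iota [set` s].
have stF : stable (gen [set` s]) by apply: stable_gen.
have dF : detects (gen [set` s]).
  by move=> g /dt[x sx gx]; exists x => //; apply: sub_gen.
have cand := candidate_of_stable fa sF stF dF.
have [e u uE iu|e [u [ed uE iu Eu]]] :=
  @exists_maximal_independent _ _ iota (gen [set` s] `&` fixed) d.
  apply: (trdeg_le (t := t) iu) => _ [i _ <-].
  by apply: (gen_min (subfield_cl iota (range t)) tt); case: (uE i).
by exists e, (gen [set` s] `&` fixed); split=> //; exists u.
Qed.

(** The powers 1, x, ..., x^m have m coordinates each over F, hence satisfy a
    linear relation. *)
Lemma degree_algebraic E F m : subfield_over iota E -> subfield_over iota F ->
  F `<=` E -> is_degree E F m -> forall x, E x -> algebraic_over F x.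
Proof.
move=> sE sF FE [b bE span] x Ex.
have [S [j [jF jP]]] := subfield_morph sF.
have coords k : exists c : 'I_m -> S, x ^+ k = \sum_i j (c i) * b i.
  have [|c [[cF ck] _]] := span (x ^+ k); first by apply: (sfX sE).
  have cj i : exists d, c i = j d by apply: jP.
  by have [d hd] := choice cj; exists d; rewrite ck; apply: eq_bigr => i _; rewrite hd.
have [c hc] := choice coords.
pose C := \matrix_(k < m.+1, i < m) c k i.
have : kermx C != 0.
  by rewrite -mxrank_eq0 mxrank_ker subn_eq0 -ltnNge ltnS rank_leq_col.
case/rowV0Pn => v /sub_kermxP vC v0.
exists (map_poly j (\poly_(k < m.+1) v 0 (inord k))); split.
- by apply/polyOver_setP=> i _; rewrite coef_map; apply: jF.
- rewrite map_poly_eq0; apply: contra_neq v0 => p0; apply/rowP => k; rewrite mxE.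
  have := congr1 (fun p : {poly S} => p`_k) p0.
  by rewrite coef_poly ltn_ord coef0 inord_val.
- rewrite /root (horner_coef_wide (n := m.+1)); last first.
    by apply: leq_trans (size_poly _ _) _; apply: size_poly.
  apply/eqP; transitivity (\sum_(k < m.+1) \sum_i j (v 0 k * C k i) * b i).
    apply: eq_bigr => k _; rewrite coef_map coef_poly ltn_ord inord_val.
    rewrite hc mulr_sumr; apply: eq_bigr => i _.
    by rewrite mxE rmorphM mulrA.
  rewrite exchange_big big1 //= => i _; rewrite -mulr_suml -rmorph_sum.
  by have := congr1 (fun M : 'rV_m => M 0 i) vC; rewrite !mxE => ->; rewrite rmorph0 mul0r.
Qed.

(** A field E realizing the descent need not be stable, but the elements of L
    algebraic over E0 form a stable set that contains E, and an element of G that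
    fixes E and L^G is trivial since these generate L. *)
Lemma compressible_of_candidate E0 d :
  ed_candidate E0 -> is_trdeg iota E0 d -> compressible d.
Proof.
move=> [sE0 E0f [E [sE E0E [m dE _] EL]]] [t [tE0 _ E0t]].
apply: (@compressible_of_stable [set x | algebraic_over E0 x] d t).
- by apply: (algebraic_base sE0); apply: sf0 sE0.
- move=> g x [p [/polyOver_setP pE p0 px]]; exists p; split=> //.
    exact/polyOver_setP.
  have -> : p = map_poly (a g) p.
    apply/polyP=> i; rewrite coef_map /=.
    have [/pE/E0f -> //|hi] := ltnP i (size p).
    by rewrite nth_default ?rmorph0.
  by rewrite /root horner_map (eqP px) rmorph0.
- move=> g [x gx]; apply: contrapT => nd; move/negP: gx; apply.
  have : [set: L] x by []; rewrite -EL; move: x.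
  apply: (gen_min (F := [set x | a g x == x])).
    apply: subfieldP => [c|y z|y z|y] /=.
    - by rewrite act_iota.
    - by rewrite rmorphB => /eqP -> /eqP ->.
    - by rewrite rmorphM => /eqP -> /eqP ->.
    - by rewrite fmorphV => /eqP ->.
  move=> x [Ex|fx]; last by rewrite /= fx.
  apply/negPn/negP => gx; apply: nd; exists x => //.
  exact: (degree_algebraic sE sE0 E0E dE).
- move=> x ax; apply: (algebraic_trans (subfield_gen _ _)).
  by apply: algebraic_mono ax => y /E0t.
Qed.

(** The bridge from the definition by descent of extensions to compressions. *)
Lemma ed_extP d : faithful ->
  is_ed_ext iota fixed d <->
  compressible d /\ forall e, compressible e -> (d <= e)%N.
Proof.
move=> fa; split=> [[[E0 cE0 tE0] mind]|[cd mind]].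
  split; first exact: compressible_of_candidate tE0.
  move=> e /(trdeg_of_compressible fa)[e' [E1 [ee' cE1 tE1]]].
  by apply: leq_trans ee'; apply: mind tE1.
split; last by move=> E0 e cE0 tE0; apply: mind; apply: compressible_of_candidate tE0.
have [e [E0 [ed cE0 tE0]]] := trdeg_of_compressible fa cd.
exists E0 => //; suff -> : d = e by [].
by apply/eqP; rewrite eqn_leq ed mind //; apply: compressible_of_candidate tE0.
Qed.

End Actions.

(** * Fractions and places *)

Section FractionMaps.
Variable D : idomainType.
Implicit Types (p q : D) (f : {fraction D}).

Lemma frac_denom f : \d_(repr f) != 0.
Proof. exact: denom_ratioP. Qed.

Lemma frac_repr f : f = tofrac \n_(repr f) / tofrac \d_(repr f).
Proof.
apply: (canRL (mulfK _)); first by rewrite tofrac_eq0 frac_denom.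
rewrite -{1}[f]reprK; set x := repr f.
rewrite -[tofrac _]/(FracField.tofrac _) /GRing.mul /= !piE.
apply/eqP; rewrite piE /FracField.equivf /FracField.mulf.
have d0 : \d_x != 0 := denom_ratioP x.
by rewrite !numden_Ratio ?oner_neq0 ?mulr1 // mulrC.
Qed.

Section Extension.
Variables (M : fieldType) (phi : {rmorphism D -> M}) (inj : injective phi).

Definition frac_ext f := phi \n_(repr f) / phi \d_(repr f).

Lemma frac_extE p q : q != 0 -> frac_ext (tofrac p / tofrac q) = phi p / phi q.
Proof.
move=> q0; rewrite /frac_ext.
have := frac_repr (tofrac p / tofrac q); set f := tofrac p / _.
have inj0 x : x != 0 -> phi x != 0 by rewrite -(inj_eq inj) rmorph0.
have qn := inj0 _ q0; have dn := inj0 _ (frac_denom f).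
move=> /eqP; rewrite eqr_div ?tofrac_eq0 ?frac_denom // -!tofracM tofrac_eq => /eqP E.
by apply/eqP; rewrite eqr_div // -!rmorphM E.
Qed.

Lemma frac_ext_zmod : zmod_morphism frac_ext.
Proof.
have inj0 x : x != 0 -> phi x != 0 by rewrite -(inj_eq inj) rmorph0.
move=> f g; rewrite {1}[f]frac_repr {1}[g]frac_repr.
have df := frac_denom f; have dg := frac_denom g.
have -> : tofrac \n_(repr f) / tofrac \d_(repr f) -
    tofrac \n_(repr g) / tofrac \d_(repr g) =
    tofrac (\n_(repr f) * \d_(repr g) - \n_(repr g) * \d_(repr f)) /
    tofrac (\d_(repr f) * \d_(repr g)).
  by rewrite -mulNr addf_div ?tofrac_eq0 // tofracB !tofracM mulNr.
rewrite frac_extE ?mulf_neq0 // rmorphB !rmorphM /frac_ext.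
by rewrite -[- (_ / _)]mulNr addf_div ?inj0 // mulNr.
Qed.

Lemma frac_ext_monoid : monoid_morphism frac_ext.
Proof.
split.
  by rewrite -[1]divr1 -[1]/(tofrac 1) frac_extE ?oner_neq0 // rmorph1 divr1.
have inj0 x : x != 0 -> phi x != 0 by rewrite -(inj_eq inj) rmorph0.
move=> f g; rewrite {1}[f]frac_repr {1}[g]frac_repr mulf_div -!tofracM.
by rewrite frac_extE ?mulf_neq0 ?frac_denom // !rmorphM mulf_div.
Qed.

Definition frac_rmorphism : {rmorphism {fraction D} -> M} :=
  HB.pack frac_ext
    (GRing.isZmodMorphism.Build {fraction D} M frac_ext frac_ext_zmod)
    (GRing.isMonoidMorphism.Build {fraction D} M frac_ext frac_ext_monoid).

End Extension.

Lemma tofrac_inj : injective (@tofrac D).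
Proof. by move=> p q /eqP; rewrite tofrac_eq => /eqP. Qed.

Lemma frac_ind (P : {fraction D} -> Prop) :
  (forall p q, q != 0 -> P (tofrac p / tofrac q)) -> forall f, P f.
Proof. by move=> h f; rewrite [f]frac_repr; apply/h/frac_denom. Qed.

End FractionMaps.

Section FractionAction.
Variables (gT : finGroupType) (K : fieldType) (D : idomainType).
Variables (iota : {rmorphism K -> D}) (s : gT -> {rmorphism D -> D}).
Hypothesis sM : forall g h p, s (g * h)%g p = s g (s h p).
Hypothesis s1 : forall p, s 1%g p = p.
Hypothesis s_iota : forall g c, s g (iota c) = iota c.

Lemma frac_action_exists :
  {a : field_action gT (@tofrac D \o iota) | forall g p, a g (tofrac p) = tofrac (s g p)}.
Proof.
have s_inj g : injective (s g).
  by apply: (can_inj (g := s g^-1%g)) => p; rewrite -sM mulVg s1.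
pose F g := frac_rmorphism (inj_comp (@tofrac_inj D) (s_inj g)).
have FE g p q : q != 0 -> F g (tofrac p / tofrac q) = tofrac (s g p) / tofrac (s g q).
  exact: (frac_extE (inj_comp (@tofrac_inj D) (s_inj g))).
have Ff g p : F g (tofrac p) = tofrac (s g p).
  have := FE g p 1 (oner_neq0 _); rewrite !rmorph1 !divr1; exact.
have FM g h x : F (g * h)%g x = F g (F h x).
  move: x; apply: frac_ind => p q q0.
  have hq0 : s h q != 0.
    by apply: contra_neq q0 => hq0; apply: (s_inj h); rewrite hq0 rmorph0.
  rewrite (FE h p q q0) (FE g _ _ hq0) (FE _ p q q0).
  exact: (congr2 (fun u v => tofrac u / tofrac v) (sM g h p) (sM g h q)).
have Fi g c : F g ((@tofrac D \o iota) c) = (@tofrac D \o iota) c.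
  rewrite -[(_ \o _) c]/(tofrac (iota c)) Ff; congr tofrac; exact: s_iota.
by exists (FieldAction FM Fi) => g p; rewrite -Ff.
Qed.

Definition frac_action := sval frac_action_exists.

Lemma frac_action_tofrac g p : frac_action g (tofrac p) = tofrac (s g p).
Proof. exact: (svalP frac_action_exists). Qed.

Lemma frac_actionE g f :
  frac_action g f = tofrac (s g \n_(repr f)) / tofrac (s g \d_(repr f)).
Proof. by rewrite {1}(frac_repr f) fmorph_div /= !frac_action_tofrac. Qed.

End FractionAction.

Section Places.
Variables (D : idomainType) (M : fieldType) (phi : {rmorphism D -> M}).
Implicit Types (f g : {fraction D}) (m n : M).

(** The place of the fraction field attached to phi: f takes the value m. It is a
    relation because f need not lie in the localization at the kernel of phi. *)
Definition spec f m := exists p q,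
  [/\ phi q != 0, f = tofrac p / tofrac q & m = phi p / phi q].

Let nz q : phi q != 0 -> q != 0.
Proof. by apply: contra_neq => ->; rewrite rmorph0. Qed.

Lemma spec_uniq f m n : spec f m -> spec f n -> m = n.
Proof.
move=> [p [q [q0 -> ->]]] [p' [q' [q'0 /eqP + ->]]].
rewrite eqr_div ?tofrac_eq0 ?nz // -!tofracM tofrac_eq => /eqP E.
by apply/eqP; rewrite eqr_div // -!rmorphM E.
Qed.

Lemma spec_tofrac p : spec (tofrac p) (phi p).
Proof. by exists p, 1; rewrite !rmorph1 !divr1 oner_neq0. Qed.

Lemma spec0 : spec 0 0.
Proof. by have := spec_tofrac 0; rewrite !rmorph0. Qed.

Lemma spec1 : spec 1 1.
Proof. by have := spec_tofrac 1; rewrite !rmorph1. Qed.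

Lemma specD f g m n : spec f m -> spec g n -> spec (f + g) (m + n).
Proof.
move=> [p [q [q0 -> ->]]] [p' [q' [q'0 -> ->]]].
exists (p * q' + p' * q), (q * q'); split; first by rewrite rmorphM mulf_neq0.
  by rewrite tofracD !tofracM addf_div ?tofrac_eq0 ?nz.
by rewrite rmorphD !rmorphM addf_div.
Qed.

Lemma specM f g m n : spec f m -> spec g n -> spec (f * g) (m * n).
Proof.
move=> [p [q [q0 -> ->]]] [p' [q' [q'0 -> ->]]].
exists (p * p'), (q * q'); split; first by rewrite rmorphM mulf_neq0.
  by rewrite !tofracM mulf_div.
by rewrite !rmorphM mulf_div.
Qed.

Lemma specN f m : spec f m -> spec (- f) (- m).
Proof.
move=> /(specM (spec_tofrac (-1))).
by rewrite !rmorphN !rmorph1 !mulN1r.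
Qed.

Lemma specB f g m n : spec f m -> spec g n -> spec (f - g) (m - n).
Proof. by move=> hf hg; apply: specD => //; apply: specN. Qed.

Lemma specV f m : m != 0 -> spec f m -> spec f^-1 m^-1.
Proof.
move=> m0 [p [q [q0 Ef Em]]]; exists q, p; rewrite Ef Em !invf_div; split=> //.
by apply: contra_neq m0 => p0; rewrite Em p0 mul0r.
Qed.

Lemma specX f m k : spec f m -> spec (f ^+ k) (m ^+ k).
Proof.
move=> h; elim: k => [|k IH]; first exact: spec1.
by rewrite !exprS; apply: specM.
Qed.

Lemma spec_sum (I : Type) (r : seq I) (F : I -> {fraction D}) (G : I -> M) :
  (forall i, spec (F i) (G i)) -> spec (\sum_(i <- r) F i) (\sum_(i <- r) G i).
Proof.
move=> h; elim: r => [|i r IH]; first by rewrite !big_nil; apply: spec0.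
by rewrite !big_cons; apply: specD.
Qed.

Lemma spec_prod (I : Type) (r : seq I) (F : I -> {fraction D}) (G : I -> M) :
  (forall i, spec (F i) (G i)) -> spec (\prod_(i <- r) F i) (\prod_(i <- r) G i).
Proof.
move=> h; elim: r => [|i r IH]; first by rewrite !big_nil; apply: spec1.
by rewrite !big_cons; apply: specM.
Qed.

Section Evaluation.
Variables (K : fieldType) (iota : {rmorphism K -> {fraction D}}).
Variables (iota' : {rmorphism K -> M}).
Hypothesis spec_iota : forall c, spec (iota c) (iota' c).

Lemma spec_mmap d (t : 'I_d -> {fraction D}) (t' : 'I_d -> M) p :
  (forall i, spec (t i) (t' i)) -> spec (mmap iota t p) (mmap iota' t' p).
Proof.
move=> h; rewrite /mmap; apply: spec_sum => k; apply: specM => //.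
by apply: spec_prod => i; apply: specX.
Qed.

Lemma spec_horner d (t : 'I_d -> {fraction D}) (t' : 'I_d -> M)
    (P : {poly {mpoly K[d]}}) x x' :
  (forall i, spec (t i) (t' i)) -> spec x x' ->
  spec (map_poly (mmap iota t) P).[x] (map_poly (mmap iota' t') P).[x'].
Proof.
move=> ht hx.
rewrite !(horner_coef_wide (n := size P)) ?size_poly //.
by apply: spec_sum => i; rewrite !coef_map; apply: specM; [apply: spec_mmap|apply: specX].
Qed.
End Evaluation.

Lemma spec_act (s : {rmorphism {fraction D} -> {fraction D}})
    (s0 : {rmorphism D -> D}) (r : {rmorphism M -> M}) :
  (forall p, s (tofrac p) = tofrac (s0 p)) -> (forall p, phi (s0 p) = r (phi p)) ->
  forall f m, spec f m -> spec (s f) (r m).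
Proof.
move=> hs hr f m [p [q [q0 -> ->]]]; exists (s0 p), (s0 q).
by rewrite !hr fmorph_eq0 !fmorph_div /= !hs.
Qed.

End Places.

Section Transfer.
Variables (gT : finGroupType) (K : fieldType) (D : idomainType) (M : fieldType).
Variables (iota : {rmorphism K -> {fraction D}}) (iota' : {rmorphism K -> M}).
Variables (a : field_action gT iota) (b : field_action gT iota').

(** A compression specializes along an equivariant place as soon as finitely many
    nonzero elements keep nonzero values: the generators, their differences (so
    that no element of the group becomes invisible), and one coefficient of each
    algebraic equation (so that the equation stays nontrivial). *)
Lemma compressible_specialize d : faithful a -> compressible a d ->
  exists2 l : seq {fraction D}, (forall f, f \in l -> f != 0) &
  forall phi : {rmorphism D -> M},
    (forall f, f \in l -> exists2 m, spec phi f m & m != 0) ->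
    (forall c, spec phi (iota c) (iota' c)) ->
    (forall g f m, spec phi f m -> spec phi (a g f) (b g m)) ->
    compressible b d.
Proof.
move=> fa [s [t [st dt tt]]].
have [P hP] : exists P : {fraction D} -> {poly {mpoly K[d]}}, forall x, x \in s ->
    map_poly (mmap iota t) (P x) != 0 /\ root (map_poly (mmap iota t) (P x)) x.
  have H x : exists P : {poly {mpoly K[d]}}, x \in s ->
    map_poly (mmap iota t) P != 0 /\ root (map_poly (mmap iota t) P) x.
    have [/tt/cl_mmapP[P hP]|_] := boolP (x \in s); first by exists P.
    by exists 0.
  by have [P hP] := choice H; exists P.
pose l0 := s ++ [seq t i | i <- enum 'I_d] ++ [seq x - y | x <- s, y <- s] ++
  [seq lead_coef (map_poly (mmap iota t) (P x)) | x <- s].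
exists [seq f <- l0 | f != 0] => [f|phi]; first by rewrite mem_filter => /andP[].
move=> hl hiota heq.
have hl0 f : f \in l0 -> f != 0 -> exists2 m, spec phi f m & m != 0.
  by move=> fl f0; apply: hl; rewrite mem_filter f0.
have hl1 f : f \in l0 -> exists m, spec phi f m.
  have [->|f0 fl] := eqVneq f 0; first by exists 0; apply: spec0.
  by have [m] := hl0 f fl f0; exists m.
pose sp f := xget 0 [set m | spec phi f m].
have spP f : f \in l0 -> spec phi f (sp f).
  by move=> /hl1[m fm]; rewrite /sp; case: xgetP => [y _ //|/(_ m)].
have s0 x : x \in s -> x \in l0 by rewrite mem_cat => ->.
have spt i : spec phi (t i) (sp (t i)).
  by apply: spP; rewrite !mem_cat map_f ?mem_enum ?orbT.
have spg g x : x \in s -> sp (a g x) = b g (sp x).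
  move=> xs; apply: spec_uniq (spP _ _) _; first exact/s0/st.
  exact/heq/spP/s0.
exists [seq sp x | x <- s], (sp \o t); split.
- move=> g _ /mapP[x xs ->]; rewrite -spg //.
  by apply: (map_f sp); apply: st.
- move=> g [y gy].
  have g1 : g != 1%g by apply: contra_neq gy => ->; rewrite act1.
  have [x xs gx] := dt g (fa g g1); exists (sp x); first exact: map_f.
  have gxs : a g x \in s by apply: st.
  rewrite -spg // -subr_eq0.
  have [||m hm m0] := hl0 (a g x - x).
  + rewrite !mem_cat; apply/orP; right; apply/orP; right; apply/orP; left.
    by apply/allpairsP; exists (a g x, x).
  + by rewrite subr_eq0.
  by rewrite (spec_uniq (specB (spP _ (s0 _ gxs)) (spP _ (s0 _ xs))) hm).
- move=> _ /mapP[x xs ->]; have [P0 Px] := hP x xs.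
  apply: (@cl_mmap _ _ iota' d (sp \o t) (P x)).
    have [||m hm m0] := hl0 (lead_coef (map_poly (mmap iota t) (P x))).
    + by rewrite !mem_cat (map_f (fun x => lead_coef (map_poly _ (P x)))) ?orbT.
    + by rewrite lead_coef_eq0.
    apply: contra_neq m0 => P00; apply: (spec_uniq hm).
    rewrite lead_coefE coef_map; set k := (_.-1).
    have := spec_mmap hiota (P x)`_k spt; congr (spec _ _ _).
    by have := congr1 (fun p : {poly M} => p`_k) P00; rewrite coef_map coef0.
  have := spec_horner hiota (P x) spt (spP _ (s0 _ xs)).
  rewrite (eqP Px) => h; apply/eqP; apply: spec_uniq h _; exact: spec0.
Qed.

End Transfer.

(** * Linear actions and generic equivariant points *)

(** Representations of the whole type, so that subgroups and products are handled
    through homomorphisms of types. *)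
Record linrep (gT : finGroupType) (K : fieldType) (n : nat) := Linrep {
  lrep :> gT -> 'M[K]_n;
  lrep1 : lrep 1%g = 1%:M;
  lrepM : forall g h, lrep (g * h)%g = lrep g *m lrep h }.

Definition lin_faithful gT K n (r : @linrep gT K n) :=
  forall g, r g = 1%:M -> g = 1%g.

Definition infinite_fixed gT K L iota (a : @field_action gT K L iota) :=
  forall N, exists s : seq L, [/\ uniq s, size s = N & forall x, x \in s -> fixed a x].

Section LinearAction.
Variables (gT : finGroupType) (K : fieldType) (n : nat) (r : linrep gT K n).

(** The action on polynomial functions on row vectors: p |-> (v |-> p (v A)). *)
Definition lin_rmorph (A : 'M[K]_n) : {rmorphism {mpoly K[n]} -> {mpoly K[n]}} :=
  comp_mpoly [tuple \sum_(j < n) A j i *: 'X_j | i < n].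

Lemma lin_rmorphX A i : lin_rmorph A 'X_i = \sum_(j < n) A j i *: 'X_j.
Proof. by rewrite /lin_rmorph /= comp_mpolyXU -tnth_nth tnth_mktuple. Qed.

Lemma lin_rmorphC A c : lin_rmorph A c%:MP = c%:MP.
Proof. by rewrite /lin_rmorph /= comp_mpolyC. Qed.

Lemma lin_rmorphM A B p : lin_rmorph (A *m B) p = lin_rmorph A (lin_rmorph B p).
Proof.
apply: (@mpoly_morph_ext _ _ _ (lin_rmorph _) (lin_rmorph A \o lin_rmorph B)) => [c|i].
  by rewrite /= !lin_rmorphC.
rewrite [RHS]/= !lin_rmorphX rmorph_sum.
under [RHS]eq_bigr do rewrite -mul_mpolyC rmorphM lin_rmorphC lin_rmorphX mulr_sumr.
rewrite exchange_big; apply: eq_bigr => j _; rewrite !mxE scaler_suml.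
by apply: eq_bigr => k _; rewrite mul_mpolyC scalerA mulrC.
Qed.

Lemma lin_rmorph1 p : lin_rmorph 1%:M p = p.
Proof.
apply: (@mpoly_morph_ext _ _ _ (lin_rmorph _) idfun) => [c|i].
  by rewrite /= lin_rmorphC.
rewrite lin_rmorphX (bigD1 i) //= mxE eqxx scale1r big1 ?addr0 // => j ji.
by rewrite mxE (negbTE ji) scale0r.
Qed.

Lemma lin_repM g h p :
  lin_rmorph (r (g * h)%g) p = lin_rmorph (r g) (lin_rmorph (r h) p).
Proof. by rewrite lrepM lin_rmorphM. Qed.

Lemma lin_rep1 p : lin_rmorph (r 1%g) p = p.
Proof. by rewrite lrep1 lin_rmorph1. Qed.

Definition lin_action : field_action gT (ratfield_const K n) :=
  frac_action lin_repM lin_rep1 (fun g => lin_rmorphC (r g)).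

Lemma lin_actionE g f : lin_action g f = ratfield_act (r g) f.
Proof. exact: frac_actionE. Qed.

Lemma lin_action_tofrac g p : lin_action g (tofrac p) = tofrac (lin_rmorph (r g) p).
Proof. exact: frac_action_tofrac. Qed.

Lemma lin_action_faithful : lin_faithful r -> faithful lin_action.
Proof.
move=> fr g g1; apply: contrapT => ng; move/negP: g1; apply; apply/eqP/fr.
apply/matrixP => j i; apply: contrapT => nij; apply: ng.
exists (tofrac 'X_i : ratfield K n); rewrite lin_action_tofrac tofrac_eq lin_rmorphX.
apply/negP => /eqP /(congr1 (fun p : {mpoly K[n]} => p@_U_(j))).
rewrite raddf_sum /= (bigD1 j) //= big1 => [|k kj].
  rewrite mcoeffZ !mcoeffXU eqxx mulr1 addr0 eq_sym => E.
  by apply: nij; rewrite E mxE.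
by rewrite mcoeffZ mcoeffXU (negbTE kj) mulr0.
Qed.

End LinearAction.

Section GenericPoint.
Variables (K M : fieldType) (iota : {rmorphism K -> M}).

Lemma nonroot_in (p : {poly M}) (s : seq M) : p != 0 -> uniq s ->
  (size p <= size s)%N -> exists2 x, x \in s & p.[x] != 0.
Proof.
move=> p0 us ps; apply: contrapT => nx.
have : all (root p) s.
  by apply/allP => x xs; apply: contrapT => /negP px; apply: nx; exists x.
by move=> /(max_poly_roots p0)/(_ us); rewrite ltnNge ps.
Qed.

Lemma mmap_eq n (q : {mpoly K[n]}) (y y' : 'I_n -> M) :
  y =1 y' -> mmap iota y q = mmap iota y' q.
Proof. by move=> /funext ->. Qed.

Lemma nonvanishing_point n (q : {mpoly K[n]}) :
  (forall N, exists s : seq M, uniq s /\ size s = N) ->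
  q != 0 -> exists y : 'I_n -> M, mmap iota y q != 0.
Proof.
move=> infM; elim: n q => [|n IH] q q0.
  exists (fun _ => 0); apply: contra_neq q0; exact: alg_independent0.
have m0 : muni q != 0 by apply: contra_neq q0 => m0; rewrite -(muniK q) m0 /munlift rmorph0 horner0.
have [|y hy] := IH (lead_coef (muni q)); first by rewrite lead_coef_eq0.
pose p := map_poly (mmap iota y) (muni q).
have p0 : p != 0.
  apply: contra_neq hy => p0; have := congr1 (fun p : {poly M} => p`_(size (muni q)).-1) p0.
  by rewrite coef_map coef0.
have [s [us ss]] := infM (size p).
have [|x _ px] := nonroot_in p0 us; first by rewrite ss.
by exists (extend y x); rewrite mmap_muni extend_widen extend_max.
Qed.

Lemma mmap_line n (q : {mpoly K[n]}) (v w : 'I_n -> M) x :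
  mmap iota (fun i => v i + x * w i) q =
  (mmap (polyC \o iota) (fun i => (v i)%:P + w i *: 'X) q).[x].
Proof.
pose h := mmap (polyC \o iota) (fun i => (v i)%:P + w i *: 'X).
apply: (@mpoly_morph_ext _ _ _ (mmap iota _) (horner_eval x \o h)) => [c|i].
  by rewrite /= /horner_eval /h !mmapC /= hornerC.
by rewrite /= /horner_eval /h !mmapX !mmap1U !hornerE mulrC.
Qed.

Variables (gT : finGroupType) (b : field_action gT iota).
Hypothesis (fb : faithful b) (infb : infinite_fixed b).

(** The scalars in front of the vectors w can be moved one by one into the fixed
    field without making q vanish: on each line q is a nonzero univariate
    polynomial and the fixed field is infinite. *)
Lemma fixed_coordinates n (q : {mpoly K[n]}) (ws : seq (M * ('I_n -> M))) v :
  mmap iota (fun i => v i + \sum_(p <- ws) p.1 * p.2 i) q != 0 ->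
  exists2 ws' : seq (M * ('I_n -> M)),
    (forall p, p \in map fst ws' -> fixed b p) /\ map snd ws' = map snd ws
  & mmap iota (fun i => v i + \sum_(p <- ws') p.1 * p.2 i) q != 0.
Proof.
elim: ws v => [|[x w] ws IH] v h; first by exists [::].
have [|ws' [fw sw] nw] := IH (fun i => v i + x * w i).
  apply: contra_neq h => E; rewrite -[RHS]E; apply: mmap_eq => i.
  by rewrite /= big_cons addrA.
pose v' i := v i + \sum_(p <- ws') p.1 * p.2 i.
pose p := mmap (polyC \o iota) (fun i => (v' i)%:P + w i *: 'X) q.
have p0 : p != 0.
  apply: contra_neq nw => p0; have := mmap_line q v' w x; rewrite -/p p0 horner0 => E.
  by rewrite -[RHS]E; apply: mmap_eq => i; rewrite /v' addrAC.
have [s [us ss fs]] := infb (size p).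
have [|y ys py] := nonroot_in p0 us; first by rewrite ss.
exists ((y, w) :: ws'); last first.
  apply: contra_neq py => E; rewrite -[RHS]E -mmap_line; apply: mmap_eq => i.
  by rewrite /v' big_cons /= addrAC addrA.
split; last by rewrite /= sw.
by move=> z /=; rewrite inE => /orP[/eqP ->|]; [apply: fs|apply: fw].
Qed.

Variables (n : nat) (r : linrep gT K n).

(** Coordinates of an equivariant map from the dual of V to M. *)
Definition equivariant (y : 'I_n -> M) :=
  forall g i, b g (y i) = \sum_k iota (r g k i) * y k.

Lemma equivariant_sum (ws : seq (M * ('I_n -> M))) :
  (forall p, p \in map fst ws -> fixed b p) ->
  (forall w, List.In w (map snd ws) -> equivariant w) ->
  equivariant (fun i => \sum_(p <- ws) p.1 * p.2 i).
Proof.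
elim: ws => [|[x w] ws IH] fw ew g i.
  by rewrite big_nil rmorph0 big1 // => k _; rewrite big_nil mulr0.
rewrite big_cons rmorphD rmorphM /= fw ?inE ?eqxx // ew; last by left.
rewrite IH; last by move=> u hu; apply: ew; right.
  rewrite mulr_sumr -big_split; apply: eq_bigr => k _ /=.
  by rewrite big_cons /= mulrDr mulrCA.
by move=> p hp; apply: fw; rewrite inE hp orbT.
Qed.

(** Hilbert 90 and density. The vectors w j k, obtained by averaging c k times the
    j-th basis vector over the group, are equivariant, and the dual family shows
    that they span all vectors over M. Start from any point where q is nonzero,
    write it in terms of the w j k, and move the scalars into the fixed field. *)
Lemma generic_point (q : {mpoly K[n]}) : q != 0 ->
  exists2 y, equivariant y & mmap iota y q != 0.
Proof.
move=> q0.
have [v hv] : exists v : 'I_n -> M, mmap iota v q != 0.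
  apply: nonvanishing_point q0 => N.
  by have [s [us ss _]] := infb N; exists s.
have sT : subfield_over iota [set: M] by apply: subfieldP.
have [|m [lam [c [_ _ dual]]]] := @exists_dual_family _ _ _ _ b [set: M] sT (fun _ _ _ => I).
  by move=> g /fb[x gx]; exists x.
pose w j k i := \sum_h iota (r h^-1%g j i) * b h (c k).
have ew j k : equivariant (w j k).
  move=> g i; rewrite rmorph_sum /=; under [RHS]eq_bigr do rewrite mulr_sumr.
  rewrite exchange_big (reindex_inj (mulgI g^-1%g)) /=; apply: eq_bigr => h _.
  rewrite rmorphM /= act_iota -actM mulgA mulgV mul1g invMg invgK lrepM mxE rmorph_sum.
  rewrite mulr_suml; apply: eq_bigr => l _; rewrite rmorphM; ring.
pose ws := [seq (v j * lam k, w j k) | j <- enum 'I_n, k <- enum 'I_m].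
have sumw i : \sum_(p <- ws) p.1 * p.2 i = v i.
  rewrite /ws big_allpairs_dep /=.
  have E j : \sum_(k <- enum 'I_m) v j * lam k * w j k i = v j * (i == j)%:R.
    rewrite big_enum /=; under eq_bigr do rewrite mulr_sumr; rewrite exchange_big /=.
    rewrite -[X in _ = v j * X](rmorph_nat iota).
    transitivity (\sum_h v j * iota (r h^-1%g j i) * \sum_k lam k * b h (c k)).
      by apply: eq_bigr => h _; rewrite mulr_sumr; apply: eq_bigr => k _; ring.
    rewrite (bigD1 1%g) //= dual eqxx invg1 lrep1 mulr1 mxE big1 ?addr0 1?eq_sym //.
    by move=> h /negbTE h1; rewrite dual h1 mulr0.
  rewrite big_enum /= (eq_bigr _ (fun j _ => E j)) (bigD1 i) //= eqxx mulr1 big1 ?addr0 //.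
  by move=> j; rewrite eq_sym => /negbTE ->; rewrite mulr0.
have [|ws' [fw sw] nw] := @fixed_coordinates n q ws (fun _ => 0).
  by apply: contra_neq hv => E; rewrite -[RHS]E; apply: mmap_eq => i; rewrite add0r sumw.
exists (fun i => \sum_(p <- ws') p.1 * p.2 i).
  apply: equivariant_sum => // u; rewrite sw => hu.
  have : exists j k, u = w j k.
    move: hu; rewrite /ws; elim: (enum 'I_n) => [|j e IH] //=.
    rewrite map_cat => H; case: (List.in_app_or _ _ _ H) => {H} [|/IH //].
    elim: (enum 'I_m) => [|k e' IH'] //= [<-|/IH' //]; by exists j, k.
  by move=> [j [k ->]].
by apply: contra_neq nw => E; rewrite -[RHS]E; apply: mmap_eq => i; rewrite add0r.
Qed.

Lemma equivariant_mmap y g p : equivariant y ->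
  mmap iota y (lin_rmorph (r g) p) = b g (mmap iota y p).
Proof.
move=> ey.
apply: (@mpoly_morph_ext _ _ _ (mmap iota y \o lin_rmorph (r g)) (b g \o mmap iota y))
  => [c|i].
  by rewrite /= lin_rmorphC mmapC act_iota.
rewrite /= lin_rmorphX raddf_sum /= mmapX mmap1U ey; apply: eq_bigr => k _.
by rewrite mmapZ mmapX mmap1U.
Qed.

(** Specialize the variables to an equivariant point of M that avoids the finitely
    many hypersurfaces on which the compression would degenerate. *)
Theorem compressible_transfer d :
  lin_faithful r -> compressible (lin_action r) d -> compressible b d.
Proof.
move=> fr cr.
have [l l0 hl] := @compressible_specialize _ _ _ M _ iota _ b d (lin_action_faithful fr) cr.
pose q := \prod_(f <- l) (\n_(repr f) * \d_(repr f)).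
have n0 (f : ratfield K n) : f != 0 -> \n_(repr f) != 0.
  by apply: contra_neq => nf; rewrite (frac_repr f) nf rmorph0 mul0r.
have q0 : q != 0.
  rewrite /q prodf_seq_neq0; apply/allP => f fl /=.
  by rewrite mulf_neq0 ?frac_denom // n0 // l0.
have [y ey yq] := generic_point q0.
apply: (hl (mmap iota y)) => [f fl|c|g f m].
- move: yq; rewrite rmorph_prod prodf_seq_neq0 => /allP/(_ f fl) /=.
  rewrite rmorphM mulf_eq0 negb_or => /andP[yn yd].
  exists (mmap iota y \n_(repr f) / mmap iota y \d_(repr f)).
    by exists \n_(repr f), \d_(repr f); split=> //; apply: frac_repr.
  by rewrite mulf_neq0 ?invr_eq0.
- by have := spec_tofrac (mmap iota y) c%:MP; rewrite /= mmapC.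
- apply: (spec_act (s0 := lin_rmorph (r g))) => p; first exact: lin_action_tofrac.
  exact: equivariant_mmap.
Qed.

End GenericPoint.

(** * The T-adic valuation on L(T) *)

Lemma infinite_fixed_powers gT K L iota (a : @field_action gT K L iota) x :
  fixed a x -> (forall i j, x ^+ i = x ^+ j -> i = j) -> infinite_fixed a.
Proof.
move=> fx xinj N; exists [seq x ^+ i | i <- seq.iota 0 N]; split.
- by rewrite map_inj_uniq ?iota_uniq // => i j /xinj.
- by rewrite size_map size_iota.
- by move=> _ /mapP[i _ ->] g; rewrite rmorphXn fx.
Qed.

Section Laurent.
Variables (gT : finGroupType) (K L : fieldType) (iota : {rmorphism K -> L}).
Variables (a : field_action gT iota) (chi : gT -> K).
Hypotheses (chiM : forall g h, chi (g * h)%g = chi g * chi h)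
  (chi0 : forall g, chi g != 0).

Lemma chi1 : chi 1%g = 1.
Proof. by apply: (mulfI (chi0 1%g)); rewrite -chiM mulg1 mulr1. Qed.

Definition twist g : {rmorphism {poly L} -> {poly L}} :=
  comp_poly (iota (chi g) *: 'X) \o map_poly (a g).

Lemma coef_twist g p i : (twist g p)`_i = a g p`_i * iota (chi g) ^+ i.
Proof.
rewrite /twist /= comp_polyE coef_sum.
under eq_bigr do rewrite exprZn scalerA coefZ coefXn coef_map /=.
have [hi|hi] := ltnP i (size (map_poly (a g) p)).
  rewrite (bigD1 (Ordinal hi)) //= eqxx mulr1 big1 ?addr0 // => j /negbTE.
  by rewrite eq_sym -val_eqE /= => ->; rewrite mulr0.
rewrite size_map_poly in hi; rewrite nth_default // rmorph0 mul0r big1 // => j _.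
case: eqP => [ij|]; last by rewrite mulr0.
by have := ltn_ord j; rewrite -ij size_map_poly ltnNge hi.
Qed.

Lemma twistM g h p : twist (g * h)%g p = twist g (twist h p).
Proof.
apply/polyP=> i; rewrite !coef_twist rmorphM rmorphXn /= act_iota actM chiM.
by rewrite rmorphM exprMn -mulrA [X in _ * X]mulrC.
Qed.

Lemma twist1 p : twist 1%g p = p.
Proof. by apply/polyP=> i; rewrite coef_twist act1 chi1 rmorph1 expr1n mulr1. Qed.

Definition poly_const : {rmorphism K -> {poly L}} := polyC \o iota.

Lemma twist_const g c : twist g (poly_const c) = poly_const c.
Proof. by rewrite /twist /poly_const /= map_polyC /= comp_polyC act_iota. Qed.

(** The variable T is multiplied by the character chi. *)
Definition laurent : field_action gT (@tofrac {poly L} \o poly_const) :=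
  frac_action twistM twist1 twist_const.

Local Notation T := (tofrac ('X : {poly L})).
Local Notation ev := (horner_eval (0 : L)).
Local Notation spec0T := (spec (ev : {rmorphism {poly L} -> L})).

Lemma laurent_tofrac g p : laurent g (tofrac p) = tofrac (twist g p).
Proof. exact: frac_action_tofrac. Qed.

Lemma twist_X g : twist g 'X = iota (chi g) *: 'X.
Proof. by rewrite /twist /= map_polyX comp_polyX. Qed.

Lemma laurent_faithful :
  (forall g, g != 1%g -> (exists x, a g x != x) \/ chi g != 1) -> faithful laurent.
Proof.
move=> h g /h[[x gx]|c1].
  exists (tofrac x%:P); rewrite laurent_tofrac tofrac_eq /twist /= map_polyC /= comp_polyC.
  by rewrite -subr_eq0 -polyCB polyC_eq0 subr_eq0.
exists T; rewrite laurent_tofrac tofrac_eq twist_X; apply: contra_neq c1.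
move=> /(congr1 (fun p : {poly L} => p`_1)); rewrite coefZ coefX mulr1 => E.
by apply: (fmorph_inj iota); rewrite E rmorph1.
Qed.

(** T^m is fixed for m the order of the group. *)
Lemma infinite_fixed_laurent : infinite_fixed laurent.
Proof.
pose m := #|gT|.
have m0 : (0 < m)%N by apply/card_gt0P; exists 1%g.
have chim g : chi g ^+ m = 1.
  have chiX k : chi (g ^+ k)%g = chi g ^+ k.
    by elim: k => [|k IH]; rewrite ?expg0 ?chi1 // expgS chiM IH exprS.
  rewrite -chiX (_ : (g ^+ m)%g = 1%g) ?chi1 //.
  by have := @expg_cardG gT (setT_group gT) g (finset.in_setT g); rewrite finset.cardsT.
apply: (@infinite_fixed_powers _ _ _ _ _ (tofrac ('X^m))) => [g|i j].
  rewrite laurent_tofrac; congr tofrac; apply/polyP=> i.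
  rewrite coef_twist coefXn rmorph_nat; case: eqP => [->|]; last by rewrite mul0r.
  by rewrite mul1r -rmorphXn chim rmorph1.
rewrite -!rmorphXn -!exprM => /eqP; rewrite tofrac_eq => /eqP.
move/(congr1 (fun p : {poly L} => size p)); rewrite !size_polyXn => -[].
by move/eqP; rewrite eqn_pmul2l // => /eqP.
Qed.

Lemma spec_const c : spec0T (tofrac (poly_const c)) (iota c).
Proof.
have := spec_tofrac (ev : {rmorphism {poly L} -> L}) (poly_const c).
by rewrite /= /horner_eval hornerC.
Qed.

Lemma spec_laurent g f m : spec0T f m -> spec0T (laurent g f) (a g m).
Proof.
apply: (spec_act (s0 := twist g)) => p; first exact: laurent_tofrac.
by rewrite /= /horner_eval !horner_coef0 coef_twist expr0 mulr1.
Qed.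

Lemma T_neq0 : T != 0 :> {fraction {poly L}}.
Proof. by rewrite tofrac_eq0 polyX_eq0. Qed.

Lemma spec_T : spec0T T 0.
Proof.
by have := spec_tofrac (ev : {rmorphism {poly L} -> L}) 'X; rewrite /= /horner_eval hornerX.
Qed.

(** The T-adic valuation of f is k, expressed by f T^-k being a unit. *)
Definition ord (f : {fraction {poly L}}) (k : int) :=
  exists2 m, spec0T (f * T ^ (- k)) m & m != 0.

Lemma ordM f g k l : ord f k -> ord g l -> ord (f * g) (k + l).
Proof.
move=> [m fm m0] [n gn n0]; exists (m * n); last by rewrite mulf_neq0.
by rewrite opprD expfzDr ?T_neq0 // mulrACA; apply: specM.
Qed.

Lemma ordV f k : ord f k -> ord f^-1 (- k).
Proof.
move=> [m fm m0]; exists m^-1; last by rewrite invr_eq0.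
by rewrite -invr_expz -invfM; apply: specV.
Qed.

Lemma ordXn f k n : ord f k -> ord (f ^+ n) (k *+ n).
Proof.
move=> h; elim: n => [|n IH].
  by exists 1; rewrite ?oner_neq0 // mulr0n oppr0 expr0z mulr1; apply: spec1.
by rewrite exprS mulrS; apply: ordM.
Qed.

Lemma ordXz f k n : ord f k -> ord (f ^ n) (k * n).
Proof.
have hn j : ord f k -> ord (f ^ Posz j) (k * Posz j).
  by move=> h; rewrite -exprnP -(natz j) mulr_natr; apply: ordXn.
by case: n => n h; [|rewrite NegzE mulrN -invr_expz; apply: ordV]; apply: hn.
Qed.

Lemma ord_unit f : ord f 0 <-> exists2 m, spec0T f m & m != 0.
Proof. by rewrite /ord oppr0 expr0z mulr1. Qed.

Lemma ord_pos f k : (0 < k)%R -> ord f k -> spec0T f 0.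
Proof.
case: k => // -[//|k] _ [m fm m0].
have := specM fm (specX k.+1 spec_T).
by rewrite -invr_expz -exprnP divfK ?expf_neq0 ?T_neq0 // exprS mul0r mulr0.
Qed.

Lemma ord_exists f : f != 0 -> exists k, ord f k.
Proof.
have ord_poly (p : {poly L}) : p != 0 -> exists k, ord (tofrac p) k.
  move=> p0; have [k [q]] := multiplicity_XsubC p 0; rewrite p0 /= subr0 => q0 ->.
  exists k%:Z, q.[0] => //; rewrite rmorphM rmorphXn /= -mulrA -exprnN mulfV.
    by rewrite mulr1; apply: (spec_tofrac (ev : {rmorphism {poly L} -> L})).
  by rewrite expf_neq0 ?T_neq0.
move=> f0; have [k hk] : exists k, ord (tofrac \n_(repr f)) k.
  by apply: ord_poly; apply: contra_neq f0 => n0; rewrite (frac_repr f) n0 rmorph0 mul0r.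
have [l hl] := ord_poly _ (frac_denom f).
by exists (k - l); rewrite (frac_repr f); apply: ordM => //; apply: ordV.
Qed.

Lemma ord_neq0 f k : ord f k -> f != 0.
Proof.
move=> [m fm m0]; apply: contra_neq m0 => f0; apply: (spec_uniq fm).
by rewrite f0 mul0r; apply: spec0.
Qed.

(** The action multiplies T by a nonzero constant, so it preserves valuations. *)
Lemma ord_act g f k : ord f k -> ord (laurent g f) k.
Proof.
have oT : ord (laurent g T) 1.
  exists (iota (chi g)); last by rewrite fmorph_eq0.
  rewrite laurent_tofrac twist_X -mul_polyC rmorphM /= exprN1 mulfK ?T_neq0 //.
  exact: spec_const.
move=> [m fm m0].
have -> : laurent g f = laurent g (f * T ^ (- k)) * laurent g T ^ k.
  have fT : f = f * T ^ (- k) * T ^ k by rewrite -invr_expz mulfVK // expfz_neq0 ?T_neq0.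
  rewrite {1}fT (rmorphM (laurent g)); congr (_ * _); exact: fmorphXz.
rewrite -[k in ord _ k]add0r -[X in 0 + X]mul1r; apply: ordM; last exact: ordXz.
by apply/ord_unit; exists (a g m); [apply: spec_laurent|rewrite fmorph_eq0].
Qed.

End Laurent.

(** * Compressions and residue fields *)

Lemma mul_exprzK (E : fieldType) (x f : E) (q : int) :
  x != 0 -> x ^ q * (f * x ^ (- q)) = f.
Proof. by move=> x0; rewrite mulrCA -expfzDr // subrr expr0z mulr1. Qed.

Lemma div_exprz_mul (E : fieldType) (x y u v : E) (q : int) :
  (x ^ q * u) / (y ^ q * v) = (x / y) ^ q * (u / v).
Proof. by rewrite invfM mulrACA expfzMl exprz_inv -invr_expz. Qed.

Lemma specXz (D : idomainType) (M : fieldType) (phi : {rmorphism D -> M}) f m (q : int) :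
  m != 0 -> spec phi f m -> spec phi (f ^ q) (m ^ q).
Proof.
move=> m0 fm; case: q => q; first exact: specX.
rewrite NegzE -!invr_expz; apply: specV; first by rewrite expf_neq0.
exact: specX.
Qed.

Section Residue.
Variables (gT : finGroupType) (K L : fieldType) (iota : {rmorphism K -> L}).
Variables (a : field_action gT iota) (chi : gT -> K).
Hypotheses (chiM : forall g h, chi (g * h)%g = chi g * chi h)
  (chi0 : forall g, chi g != 0).

Notation b := (laurent a chiM chi0).
Notation LT := {fraction {poly L}}.
Notation spec := (spec (horner_eval (0 : L) : {rmorphism {poly L} -> L})).
Notation iotaT := (@tofrac {poly L} \o poly_const iota).

Variables (F : set LT) (sF : subfield_over iotaT F) (stF : stable b F).
Hypothesis dF : forall g, g != 1%g -> exists2 x, F x & b g x != x.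

Let spec_b g f m : spec f m -> spec (b g f) (a g m).
Proof. exact: spec_laurent. Qed.

(** The residue field of the restriction to F of the T-adic valuation. *)
Definition residues : set L := [set m | exists2 f, F f & spec f m].

Lemma subfield_residues : subfield_over iota residues.
Proof.
apply: subfieldP => [c|x y [f Ff fx] [g Fg gy]|x y [f Ff fx] [g Fg gy]|x [f Ff fx]].
- by exists (iotaT c); [apply: (sf_iota sF)|apply: spec_const].
- by exists (f - g); [apply: (sfB sF)|apply: specB].
- by exists (f * g); [apply: (sfM sF)|apply: specM].
- have [->|x0] := eqVneq x 0; first by exists 0; [apply: (sf0 sF)|rewrite invr0; apply: spec0].
  by exists f^-1; [apply: (sfV sF)|apply: specV].
Qed.

Lemma stable_residues : stable a residues.
Proof. by move=> g x [f Ff fx]; exists (b g f); [apply: stF|apply: spec_laurent]. Qed.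

(** If the valuation were trivial on F, reduction would embed F into L
    equivariantly, and h would act trivially on F. *)
Lemma exists_positive (h : gT) : h != 1%g -> (forall x, a h x = x) ->
  exists f (k : nat), F f /\ ord f k.+1.
Proof.
move=> h1 ah; have [x Fx hx] := dF h1.
apply: contrapT => npos.
have all0 f : F f -> f != 0 -> exists2 m, spec f m & m != 0.
  move=> Ff f0; have [k fk] := ord_exists f0; apply/ord_unit.
  case: k fk => [[//|k]|k] fk; case: npos; first by exists f, k.
  by exists f^-1, k; split; [apply: (sfV sF)|apply: (ordV fk)].
have y0 : b h x - x != 0 by rewrite subr_eq0.
have Fy : F (b h x - x) by apply: (sfB sF) => //; apply: stF.
have x0 : x != 0 by apply: contra_neq hx => ->; rewrite rmorph0.
have [m xm _] := all0 x Fx x0; have [n yn] := all0 _ Fy y0; case/eqP.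
apply: (spec_uniq yn).
by have := specB (spec_b h xm) xm; rewrite ah subrr.
Qed.

Lemma exists_uniformizer (h : gT) : h != 1%g -> (forall x, a h x = x) ->
  exists pi, [/\ F pi, pi != 0, spec pi 0 &
    forall f, F f -> f != 0 -> exists (q : int) w,
      [/\ F w, f = pi ^ q * w & exists2 m, spec w m & m != 0]].
Proof.
move=> h1 ah.
pose P n := `[< exists f, F f /\ ord f (Posz n.+1) >].
have exP : exists n, P n.
  by have [f [k fk]] := exists_positive h1 ah; exists k; apply/asboolP; exists f.
case: (ex_minnP exP) => e /asboolP[pi [Fpi pie]] emin.
have pi0 := ord_neq0 pie.
exists pi; split=> //; first exact: ord_pos pie.
move=> f Ff f0; have [k fk] := ord_exists f0.
pose q := (k %/ Posz e.+1)%Z.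
have Fw : F (f * pi ^ (- q)).
  apply: (sfM sF) => //; case: (- q) => n; first exact: (sfX sF).
  by rewrite NegzE -invr_expz; apply: (sfV sF); apply: (sfX sF).
exists q, (f * pi ^ (- q)); split; [exact: Fw|exact: esym (mul_exprzK f q pi0)|].
apply/ord_unit.
have ow : ord (f * pi ^ (- q)) (k %% Posz e.+1)%Z.
  rewrite (_ : (k %% _)%Z = k + Posz e.+1 * - q); first by apply: ordM => //; apply: ordXz.
  by rewrite {2}(divz_eq k (Posz e.+1)) -/q mulrN mulrC [_ * q]mulrC addrAC subrr add0r.
have := modz_ge0 k (isT : Posz e.+1 != 0); have := ltz_pmod k (isT : 0 < Posz e.+1)%R.
case: (k %% _)%Z ow => // -[//|r] ow; rewrite ltz_nat ltnS => re _.
have /emin : P r by apply/asboolP; exists (f * pi ^ (- q)).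
by rewrite leqNgt re.
Qed.

(** The wild part of inertia, defined without reference to a uniformizer so that
    its normality is visible. *)
Definition wild : {set gT} :=
  [set g | `[< forall f, F f -> f != 0 -> spec (b g f / f) 1 >]]%SET.

Lemma wildP g : reflect (forall f, F f -> f != 0 -> spec (b g f / f) 1) (g \in wild).
Proof. by rewrite finset.inE; apply: asboolP. Qed.

Lemma wild_group_set : group_set wild.
Proof.
apply/group_setP; split=> [|g h /wildP hg /wildP hh]; apply/wildP => f Ff f0.
  by rewrite act1 divff //; apply: spec1.
have hf0 : b h f != 0 by rewrite fmorph_eq0.
have := specM (hg _ (stF h Ff) hf0) (hh f Ff f0).
by rewrite mulr1 actM mulrA divfK.
Qed.
Canonical wild_group := group wild_group_set.

Lemma wild_normal : (wild <| [set: gT]%SET)%g.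
Proof.
apply/normalP; split; first exact: finset.subsetT.
move=> x _; apply/eqP; rewrite eqEcard cardJg leqnn andbT.
apply/fintype.subsetP => y /imsetP[g /wildP hg ->]; apply/wildP => f Ff f0.
have xf0 : b x f != 0 by rewrite fmorph_eq0.
have := spec_b x^-1%g (hg _ (stF x Ff) xf0).
rewrite rmorph1 fmorph_div /= -!actM mulVg act1.
by rewrite /conjg mulgA.
Qed.

(** Let f in F be moved by g and subtract from q f the sum of its conjugates under
    the powers of g. If q is invertible, the result y is nonzero and has trace 0;
    but each g^i y / y has residue 1, so the trace of y divided by y has
    residue q. *)
Lemma wild_order g q : prime q -> g \in wild -> #[g]%g = q -> q%:R = 0 :> L.
Proof.
move=> pq gw og.
have g1 : g != 1%g by rewrite -order_gt1 og prime_gt1.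
have [f Ff gf] := dF g1.
pose tr (z : LT) := \sum_(i < q) b (g ^+ i)%g z.
have tr_fixed z i : b (g ^+ i)%g (tr z) = tr z.
  have tr1 : b g (tr z) = tr z.
    rewrite /tr rmorph_sum /=; under eq_bigr do rewrite -actM -expgS.
    case: (q) (prime_gt0 pq) og => // k _ og.
    by rewrite big_ord_recr [RHS]big_ord_recl /= -og expg_order addrC expg0.
  by elim: i => [|i IH]; rewrite ?expg0 ?act1 // expgS actM IH.
have trF z : F z -> F (tr z) by move=> Fz; apply: (sf_sum sF) => i _; apply: stF.
apply: contrapT => /eqP q0.
have qT : q%:R != 0 :> LT.
  apply: contra_neq q0 => qT.
  have := spec_tofrac (horner_eval (0 : L) : {rmorphism {poly L} -> L}) q%:R.
  by rewrite !rmorph_nat qT => h; apply: spec_uniq h _; apply: spec0.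
pose y := f * q%:R - tr f.
have Fy : F y.
  apply: (sfB sF); last exact: trF.
  by apply: (sfM sF) => //; rewrite -(rmorph_nat iotaT); apply: (sf_iota sF).
have y0 : y != 0.
  apply: contra_neq gf => /eqP; rewrite subr_eq0 => /eqP fq.
  apply: (mulIf qT); rewrite -[X in _ * X](rmorph_nat (b g)) -rmorphM fq.
  exact: (tr_fixed f 1%N).
have try0 : tr y = 0.
  rewrite /tr /y; under eq_bigr do rewrite rmorphB rmorphM rmorph_nat /= tr_fixed.
  by rewrite sumrB -mulr_suml sumr_const card_ord mulr_natr subrr.
have := @spec_sum _ _ (horner_eval (0 : L) : {rmorphism {poly L} -> L}) _
  (index_enum 'I_q) (fun i => b (g ^+ i)%g y / y) (fun=> 1).
rewrite -mulr_suml -/(tr y) try0 mul0r sumr_const card_ord => h.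
move/eqP: q0; apply; apply/esym/(spec_uniq (spec0 _))/h => i.
by have /wildP := groupX i gw; apply.
Qed.

Variables (p : nat).
Hypotheses (pp : prime p) (pK : p%:R != 0 :> K).
Hypothesis solp : forall N : {group gT}, (N <| [set: gT]%SET)%g -> solvable N ->
  forall x, x \in N -> (x ^+ p)%g = 1%g.

(** By the previous lemma the wild part is a group of order a power of the
    characteristic, hence solvable, hence of exponent p; and p is invertible. *)
Lemma wild_trivial : wild = 1%g.
Proof.
apply: contrapT => /eqP; rewrite trivg_card1 => w1.
have prime0 q : prime q -> (q %| #|wild|)%N -> q \in [pchar L].
  move=> pq /(Cauchy pq)[g gw og]; rewrite inE pq /=; apply/eqP.
  exact: wild_order og.
have [q pq qw] : exists2 q, prime q & (q %| #|wild|)%N.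
  by exists (pdiv #|wild|); rewrite ?pdiv_dvd ?pdiv_prime // ltn_neqAle eq_sym w1 cardG_gt0.
have qL := prime0 q pq qw.
have pw : (q.-group wild)%g.
  apply/pgroupP => r pr rw; rewrite inE /=; have := prime0 r pr rw.
  by rewrite (pcharf_eq qL).
have [g gw og] := Cauchy pq qw.
have := solp wild_normal (pgroup_sol pw) gw => /eqP; rewrite -order_dvdn og.
rewrite dvdn_prime2 // => /eqP qp; move/negP: pK; apply.
by rewrite -(fmorph_eq0 iota) rmorph_nat -qp; case/andP: qL.
Qed.

Definition inertia : {set gT} := [set g | `[< forall m, residues m -> a g m = m >]]%SET.

Lemma inertiaP g : reflect (forall m, residues m -> a g m = m) (g \in inertia).
Proof. by rewrite finset.inE; apply: asboolP. Qed.

Lemma inertia_group_set : group_set inertia.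
Proof.
apply/group_setP; split=> [|g h /inertiaP hg /inertiaP hh]; apply/inertiaP => m Rm.
  by rewrite act1.
by rewrite actM hh ?hg.
Qed.
Canonical inertia_group := group inertia_group_set.

Lemma inertia_normal : (inertia <| [set: gT]%SET)%g.
Proof.
apply/normalP; split; first exact: finset.subsetT.
move=> x _; apply/eqP; rewrite eqEcard cardJg leqnn andbT.
apply/fintype.subsetP => y /imsetP[g /inertiaP hg ->]; apply/inertiaP => m Rm.
rewrite /conjg !actM hg -?actM ?mulVg ?act1 //; exact: stable_residues.
Qed.

(** The residue theta g of g pi / pi is multiplicative on inertia, and its kernel
    is wild since every element of F is a power of pi times a unit. So inertia is
    a finite subgroup of the units of L. *)
Lemma inertia_cyclic h : h != 1%g -> (forall x, a h x = x) -> cyclic inertia.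
Proof.
move=> h1 ah; have [pi [Fpi pi0 _ unif]] := exists_uniformizer h1 ah.
have Fg g : F (b g pi) by apply: stF.
have opi g : exists2 m, spec (b g pi / pi) m & m != 0.
  have [k kpi] := ord_exists pi0; apply/ord_unit; rewrite -(subrr k).
  by apply: ordM; [apply: ord_act|apply: ordV].
pose theta g := xget 0 [set m | spec (b g pi / pi) m].
have thetaP g : spec (b g pi / pi) (theta g).
  by have [m hm _] := opi g; rewrite /theta; case: xgetP => [y _ //|/(_ m)].
have Rtheta g : residues (theta g).
  by exists (b g pi / pi) => //; apply: (sfM sF) => //; apply: (sfV sF).
apply: (@field_mul_group_cyclic _ _ _ theta).
  move=> g k gI kI.
  have /inertiaP ag := gI.
  apply: (spec_uniq (thetaP (g * k)%g)).
  have := specM (spec_b g (thetaP k)) (thetaP g).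
  rewrite (ag _ (Rtheta k)) [_ * theta g]mulrC fmorph_div /= -actM mulrA divfK ?fmorph_eq0 //.
move=> g gI; split=> [tg|->]; last first.
  by apply: (spec_uniq (thetaP 1%g)); rewrite act1 divff //; apply: spec1.
have /inertiaP ag := gI.
suff : g \in wild by rewrite wild_trivial => /set1gP.
apply/wildP => f Ff f0; have [q [w [Fw -> [m wm m0]]]] := unif f Ff f0.
have gw : spec (b g w / w) 1.
  rewrite -(divff m0) -{1}(ag m); last by exists w.
  by apply: specM; [apply: spec_b|apply: specV].
have gpi : spec (b g pi / pi) 1 by rewrite -tg; apply: thetaP.
rewrite rmorphM /= (fmorphXz (b g)) div_exprz_mul.
have := specM (specXz q (oner_neq0 L) gpi) gw.
by rewrite exp1rz mulr1.
Qed.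

(** Inertia is cyclic and normal, hence of exponent p, hence of order at most p. It
    contains h, so it is generated by h and acts trivially on L. *)
Lemma residues_detect h : h != 1%g -> (forall x, a h x = x) -> detects a residues.
Proof.
move=> h1 ah g [x gx].
have cyc := inertia_cyclic h1 ah.
have expI y : y \in inertia -> (y ^+ p)%g = 1%g.
  exact: (solp inertia_normal (abelian_sol (cyclic_abelian cyc))).
have hI : h \in inertia by apply/inertiaP => m _.
have oh : #[h]%g = p.
  apply/(prime_nt_dvdP pp); first by rewrite order_eq1.
  by rewrite order_dvdn; apply/eqP/expI.
have Ih : inertia \subset <[h]>%g.
  have [z zI] := cyclicP cyc.
  have : (#|inertia| %| p)%N.
    by rewrite /= zI [#|_|]/(#[z]%g) order_dvdn; apply/eqP/expI; rewrite zI cycle_id.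
  move=> Ip; have hs : (<[h]> \subset inertia)%g by rewrite cycle_subG.
  have /eqP <- : <[h]>%g == inertia; last exact: fintype.subxx.
  by rewrite eqEcard hs -[#|<[h]>%g|]/(#[h]%g) oh dvdn_leq ?prime_gt0.
apply: contrapT => nR.
have : g \in inertia.
  apply/inertiaP => m Rm; apply: contrapT => /eqP gm; apply: nR; exists m => //.
move=> /(fintype.subsetP Ih)/cycleP[k gk]; move/eqP: gx; apply.
rewrite gk; elim: k {gk} => [|k IH]; first by rewrite expg0 act1.
by rewrite expgS actM IH ah.
Qed.

(** Lifts of independent residues together with pi are independent: in a relation,
    divide by the lowest power of pi and reduce to get a relation between the
    residues. *)
Lemma residues_trdeg h d (t : 'I_d -> LT) : h != 1%g -> (forall x, a h x = x) ->
  F `<=` cl iotaT (range t) ->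
  forall e (u : 'I_e -> L), (forall i, residues (u i)) -> alg_independent iota u ->
  (e.+1 <= d)%N.
Proof.
move=> h1 ah Ft e u Ru iu; have [pi [Fpi pi0 pis _]] := exists_uniformizer h1 ah.
have Ru' i : exists f, F f /\ spec f (u i) by have [f Ff fu] := Ru i; exists f.
have [f hf] := choice Ru'.
have fu i : spec (f i) (u i) by case: (hf i).
apply: (@trdeg_le _ _ iotaT e.+1 d (extend f pi) t); last first.
  move=> _ [i _ <-]; apply: Ft; rewrite /extend; case: unliftP => [j _|//].
  by case: (hf j).
have sc c : spec (iotaT c) (iota c) := spec_const iota c.
move=> q; rewrite mmap_muni extend_widen extend_max => q0.
rewrite -(muniK q); suff -> : muni q = 0 by rewrite /munlift rmorph0 horner0.
move: q0; set P := muni q => P0; apply: contrapT => /eqP nP.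
(* k is the order of P, as a polynomial in its last variable, at 0 *)
have exk : exists k, P`_k != 0.
  by exists (size P).-1; rewrite -lead_coefE lead_coef_eq0.
case: (ex_minnP exk) => k Pk kmin.
have take0 : take_poly k P = 0.
  apply/polyP=> i; rewrite coef_take_poly coef0; case: ltnP => // ik.
  by apply: contrapT => /eqP /kmin; rewrite leqNgt ik.
have EP : P = drop_poly k P * 'X^k by rewrite -[LHS](poly_take_drop k) take0 add0r.
move: P0; rewrite {1}EP rmorphM rmorphXn /= map_polyX hornerM hornerXn => /eqP.
rewrite mulf_eq0 expf_eq0 (negbTE pi0) andbF orbF => /eqP P0.
have := spec_horner sc (drop_poly k P) fu pis.
rewrite P0 horner_coef0 coef_map coef_drop_poly add0n => h0.
move/negP: Pk; apply; apply/eqP/iu; apply: spec_uniq h0 _; exact: spec0.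
Qed.

End Residue.

(** Passing to the residue field lowers the dimension of a compression by one. The
    condition on solvable normal subgroups makes inertia no larger than the kernel
    of the action on L, which is generated by h. *)
Theorem compressible_residue (gT : finGroupType) (K L : fieldType)
    (iota : {rmorphism K -> L}) (a : field_action gT iota) (chi : gT -> K)
    (chiM : forall g h, chi (g * h)%g = chi g * chi h)
    (chi0 : forall g, chi g != 0) (p d : nat) (h : gT) :
  prime p -> p%:R != 0 :> K ->
  (forall N : {group gT}, (N <| [set: gT]%SET)%g -> solvable N ->
    forall x, x \in N -> (x ^+ p)%g = 1%g) ->
  h != 1%g -> (forall x, a h x = x) ->
  faithful (laurent a chiM chi0) ->
  compressible (laurent a chiM chi0) d ->
  exists2 e, d = e.+1 & compressible a e.
Proof.
move=> pp pK solp h1 ah fb [s [t [ss ds st]]].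
pose F := field_gen (@tofrac {poly L} \o poly_const iota) [set` s].
have sF : subfield_over (@tofrac {poly L} \o poly_const iota) F by apply: subfield_gen.
have stF : stable (laurent a chiM chi0) F by apply: stable_gen.
have dF g : g != 1%g -> exists2 x, F x & laurent a chiM chi0 g x != x.
  by move=> /fb/ds[x sx gx]; exists x => //; apply: sub_gen.
have Ft : F `<=` cl (@tofrac {poly L} \o poly_const iota) (range t).
  by apply: gen_min st; apply: subfield_cl.
have bound := residues_trdeg sF stF dF h1 ah Ft.
case: d t st Ft bound => [|d] t st Ft bound.
  have := bound 0%N (fun _ => 0); rewrite ltn0 => H.
  have // : false by apply: H; [case|apply: alg_independent0].
exists d => //.
have [e [u [ed _ _ Ru]]] := exists_maximal_independent bound.
apply: (compressible_le ed); apply: (compressible_of_stable (F := residues F)) Ru.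
- exact: (sf0 (subfield_residues sF)).
- exact: (stable_residues stF).
- exact: (residues_detect sF stF dF pp pK solp h1 ah).
Qed.

(** * Essential dimension of an abstract finite group *)

Lemma tofrac_mmap (K : fieldType) n (p : {mpoly K[n]}) :
  tofrac p = mmap (ratfield_const K n) (fun i => tofrac 'X_i) p.
Proof.
apply: (@mpoly_morph_ext _ _ _ (@tofrac {mpoly K[n]}) (mmap (ratfield_const K n) _)).
  by move=> c; rewrite /= mmapC.
by move=> i; rewrite /= mmapX mmap1U.
Qed.

Lemma cl_variables (K : fieldType) n (f : ratfield K n) :
  cl (ratfield_const K n) (range (fun i : 'I_n => tofrac 'X_i : ratfield K n)) f.
Proof.
have sF := subfield_gen (ratfield_const K n)
  (range (fun i : 'I_n => tofrac 'X_i : ratfield K n)).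
apply: (algebraic_base sF); rewrite (frac_repr f).
have h p : field_gen (ratfield_const K n)
    (range (fun i : 'I_n => tofrac 'X_i : ratfield K n)) (tofrac p).
  rewrite tofrac_mmap; apply: (sf_mmap sF) => i.
  by apply: sub_gen; exists i.
by apply: (sfM sF); [|apply: (sfV sF)].
Qed.

Lemma compressible_dim gT (K : fieldType) n (r : linrep gT K n) :
  compressible (lin_action r) n.
Proof.
apply: (@compressible_of_stable _ _ _ _ (lin_action r) [set: ratfield K n] n
  (fun i : 'I_n => tofrac 'X_i)) => //.
  by move=> g [x gx]; exists x.
by move=> f _; apply: cl_variables.
Qed.

Lemma compressible_trivial gT (K L : fieldType) (iota : {rmorphism K -> L})
    (a : field_action gT iota) d : (forall g : gT, g = 1%g) -> compressible a d.
Proof.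
move=> g1; exists [::], (fun _ => 0); split=> //.
by move=> g [x]; rewrite (g1 g) act1 eqxx.
Qed.

(** The norm P of a variable is fixed and is not constant, since it vanishes at the
    origin; its powers have distinct leading monomials. *)
Lemma infinite_fixed_linear gT (K : fieldType) n (r : linrep gT K n.+1) :
  infinite_fixed (lin_action r).
Proof.
pose P : {mpoly K[n.+1]} := \prod_(g : gT) lin_rmorph (r g) 'X_ord0.
have P0 : P != 0.
  apply/prodf_neq0 => g _; apply/eqP => /(congr1 (lin_rmorph (r g^-1%g))).
  rewrite -lin_repM mulVg lin_rep1 rmorph0 => /(congr1 (mcoeff U_(ord0))) /eqP.
  by rewrite mcoeffXU eqxx mcoeff0 oner_eq0.
have lP : mlead P != 0%MM.
  apply: contra_neq P0 => lP.
  have EP : P = (P@_0%MM)%:MP.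
    apply/mpolyP=> m; rewrite mcoeffC; have [->|m0] := eqVneq m 0%MM; first by rewrite mulr1.
    by rewrite mulr0 mcoeff_gt_mlead // lP Order.POrderTheory.lt_def m0 le0m.
  suff : meval (fun _ => 0) P = 0.
    by rewrite {1}EP mevalC => E; rewrite EP E mpolyC0.
  rewrite rmorph_prod /= (bigD1 1%g) //= lin_rep1 mevalXU mul0r //.
have [k lk] : exists k, mlead P k != 0%N.
  apply: contrapT => nk; move/negP: lP; apply; apply/eqP/mnmP => k; rewrite mnm0E.
  by apply: contrapT => /eqP lk; apply: nk; exists k.
apply: (@infinite_fixed_powers _ _ _ _ _ (tofrac P)) => [g|i j].
  rewrite lin_action_tofrac; congr tofrac; rewrite /P rmorph_prod /=.
  rewrite [RHS](reindex_inj (mulgI g)); apply: eq_bigr => h _.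
  exact: esym (lin_repM r g h _).
rewrite -!tofracXn => /eqP; rewrite tofrac_eq => /eqP.
move/(congr1 (fun p => mlead p k)); rewrite !mleadX // !mulmnE => /eqP.
by rewrite eqn_pmul2l ?lt0n // => /eqP.
Qed.

Section Pullback.
Variables (gT hT : finGroupType) (K L : fieldType) (iota : {rmorphism K -> L}).
Variables (a : field_action gT iota) (f : hT -> gT).
Hypothesis fM : forall x y, f (x * y)%g = (f x * f y)%g.

Definition pullback : field_action hT iota :=
  @FieldAction _ _ _ iota (fun x => a (f x))
    (fun x y z => etrans (congr1 (fun u => a u z) (fM x y)) (actM a (f x) (f y) z))
    (fun x => act_iota a (f x)).

Lemma compressible_pullback d : compressible a d -> compressible pullback d.
Proof.
move=> [s [t [ss ds st]]]; exists s, t; split=> // [x y|x].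
  exact: (ss (f x) y).
exact: (ds (f x)).
Qed.
End Pullback.

Lemma compressible_ext gT (K L : fieldType) (iota : {rmorphism K -> L})
    (a b : field_action gT iota) d :
  (forall g x, a g x = b g x) -> compressible a d -> compressible b d.
Proof.
move=> ab [s [t [ss ds st]]]; exists s, t; split=> // [g x|g [x]].
  by move=> /ss; rewrite -ab; apply.
rewrite -ab => gx; have [|y ys gy] := ds g; first by exists x.
by exists y; rewrite -?ab.
Qed.

(** One faithful representation is enough to look at, by [ed_le_transfer]. *)
Definition ed_le (K : fieldType) (gT : finGroupType) d :=
  exists n (r : linrep gT K n), lin_faithful r /\ compressible (lin_action r) d.

Lemma ed_le_transfer (K M : fieldType) (iota : {rmorphism K -> M}) gT
    (b : field_action gT iota) d :
  ed_le K gT d -> faithful b -> infinite_fixed b -> compressible b d.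
Proof. by move=> [n [r [fr cr]]] fb ib; apply: compressible_transfer fr cr. Qed.

Lemma faithful_linrep_exists (K : fieldType) gT :
  exists n (r : linrep gT K n.+1), lin_faithful r.
Proof.
pose G := setT_group gT.
have hM : forall g h, regular_mx K G (g * h)%g = regular_mx K G g *m regular_mx K G h.
  by move=> g h; apply: (repr_mxM (regular_repr K G)); rewrite finset.inE.
have hf : forall g, regular_mx K G g = 1%:M -> g = 1%g.
  move=> g g1; apply: (mx_faithful_inj (regular_mx_faithful K G)); rewrite ?finset.inE //.
  by rewrite repr_mx1.
have h1 : regular_mx K G 1%g = 1%:M := repr_mx1 (regular_repr K G).
have [m [m0 [r fr]]] : exists m, (0 < m)%N /\ exists r : linrep gT K m, lin_faithful r.
  by eexists; split; [exact: (cardG_gt0 G)|exists (Linrep h1 hM)].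
by case: m m0 r fr => // m _ r fr; exists m, r.
Qed.

Lemma ed_le_hom (K : fieldType) (gT hT : finGroupType) (f : hT -> gT) d :
  (forall x y, f (x * y)%g = (f x * f y)%g) -> injective f ->
  ed_le K gT d -> ed_le K hT d.
Proof.
move=> fM fi [n [r [fr cr]]].
have f1 : f 1%g = 1%g by apply: (mulgI (f 1%g)); rewrite -fM !mulg1.
have rM x y : r (f (x * y)%g) = r (f x) *m r (f y) by rewrite fM lrepM.
have r1 : r (f 1%g) = 1%:M by rewrite f1 lrep1.
exists n, (@Linrep _ _ _ (fun x => r (f x)) r1 rM); split.
  by move=> x /fr; rewrite -f1; apply: fi.
apply: (compressible_ext _ (compressible_pullback fM cr)) => x y.
by rewrite lin_actionE /= -lin_actionE.
Qed.

(** A faithful G-field L is compressed through L(T), where C acts only on T. *)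
Theorem ed_le_prod (K : fieldType) (gT C : finGroupType) (chi : C -> K) p d :
  (forall x y, chi (x * y)%g = chi x * chi y) -> (forall x, chi x != 0) ->
  (forall x, chi x = 1 -> x = 1%g) -> (exists c : C, c != 1%g) ->
  prime p -> p%:R != 0 :> K ->
  (forall N : {group gT * C}, (N <| [set: gT * C]%SET)%g -> solvable N ->
    forall x, x \in N -> (x ^+ p)%g = 1%g) ->
  ed_le K (gT * C)%type d -> exists2 e, d = e.+1 & ed_le K gT e.
Proof.
move=> chiM chi0 chi1 [c c1] pp pK solp ed.
have [n [r fr]] := faithful_linrep_exists K gT.
have fstM (x y : gT * C) : (x * y)%g.1 = (x.1 * y.1)%g by [].
have chiM' (x y : gT * C) : chi (x * y)%g.2 = chi x.2 * chi y.2 by rewrite -chiM.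
pose a := pullback (lin_action r) fstM.
have fb : faithful (laurent a chiM' (fun x => chi0 x.2)).
  apply: laurent_faithful => -[x y] xy1.
  have [x1|x1] := eqVneq x 1%g.
    by right; apply: contra_neq xy1 => /chi1 /= ->; rewrite x1.
  by left; have [z xz] := lin_action_faithful fr x1; exists z.
have ib := infinite_fixed_laurent a chiM' (fun x => chi0 x.2).
have [||e -> ce] := compressible_residue (h := (1%g, c)) pp pK solp _ _ fb
    (ed_le_transfer ed fb ib).
- by apply: contra_neq c1 => -[].
- by move=> x; rewrite /= act1.
exists e => //; exists n.+1, r; split=> //.
have inM (x y : gT) : ((x * y)%g, 1%g : C) = ((x, 1%g) * (y, 1%g))%g.
  rewrite -[RHS]/((x * y)%g, (1 * 1)%g : C). by rewrite mulg1.
apply: (compressible_ext _ (compressible_pullback inM ce)) => x y //.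
Qed.

Lemma gen_base_change (K K' L : fieldType) (j : {rmorphism K -> K'})
    (iota : {rmorphism K' -> L}) (A : set L) :
  cl (iota \o j) A `<=` cl iota A.
Proof.
have h : field_gen (iota \o j) A `<=` field_gen iota A.
  have sF := subfield_gen iota A.
  apply: gen_min; last exact: sub_gen.
  by apply: subfieldP => [c|x y|x y|x]; [apply: (sf_iota sF)|apply: (sfB sF)|
    apply: (sfM sF)|apply: (sfV sF)].
by move=> x; apply: algebraic_mono.
Qed.

(** Specialize the compression over K to a faithful representation over K', viewed
    as a field over K: algebraic dependence over K implies dependence over K'. *)
Lemma ed_le_base_change (K K' : fieldType) (j : {rmorphism K -> K'}) gT d :
  ed_le K gT d -> ed_le K' gT d.
Proof.
move=> ed; have [n [r fr]] := faithful_linrep_exists K' gT.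
pose b : field_action gT (ratfield_const K' n.+1 \o j) :=
  @FieldAction _ _ _ (ratfield_const K' n.+1 \o j) (lin_action r) (actM (lin_action r))
    (fun g c => act_iota (lin_action r) g (j c)).
have [s [t [ss ds st]]] : compressible b d.
  apply: ed_le_transfer ed _ _; first exact: (lin_action_faithful fr).
  exact: (infinite_fixed_linear r).
exists n.+1, r; split=> //; exists s, t; split=> //.
by apply: subset_trans st _; apply: gen_base_change.
Qed.

Section ConstantField.
Variables (K : fieldType) (n : nat).
Notation iota := (ratfield_const K n).
Notation alg := (algebraicOver iota).

(** In an equation for p / q with nonzero constant term, multiplied by a power of
    q, the term without p would have a leading monomial larger than all others. *)
Lemma algebraic_mlead (p q : {mpoly K[n]}) : p != 0 -> q != 0 ->
  alg (tofrac p / tofrac q) -> ~~ (mlead p < mlead q)%O.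
Proof.
move=> p0 q0 [P P0 Px]; apply/negP => pq.
have [k [Q]] := multiplicity_XsubC P 0; rewrite P0 /= subr0 => Q0 EP.
have {}Px : root (map_poly iota Q) (tofrac p / tofrac q).
  move: Px; rewrite EP rmorphM rmorphXn /= map_polyX /root hornerM hornerXn mulf_eq0.
  by rewrite expf_eq0 mulf_eq0 invr_eq0 !tofrac_eq0 (negbTE p0) (negbTE q0) andbF orbF.
pose N := size Q.
have sum0 : \sum_(i < N) Q`_i *: (p ^+ i * q ^+ (N - i)) = 0.
  apply/eqP; rewrite -tofrac_eq0 rmorph_sum; move/eqP: Px.
  rewrite (horner_coef_wide (n := N)) ?size_poly // => /(congr1 ( *%R^~ (tofrac q ^+ N))).
  rewrite mul0r mulr_suml => Px; apply/eqP; rewrite -[RHS]Px; apply: eq_bigr => i _.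
  rewrite coef_map -mul_mpolyC !rmorphM !rmorphXn /= -[tofrac (Q`_i)%:MP]/(iota Q`_i).
  rewrite exprMn exprVn -!mulrA; congr (_ * (_ * _)).
  rewrite expfB_cond; last by rewrite tofrac_eq0 (negbTE q0) add0n ltnW.
  exact: mulrC.
move: Q0; rewrite /root horner_coef0 => /eqP Q0; apply: Q0.
have N0 : (0 < N)%N by rewrite lt0n size_poly_eq0; apply: contra_neq P0 => Q0; rewrite EP Q0 mul0r.
move: sum0; case: (N) N0 => // N' _.
move/(congr1 (mcoeff (mlead q *+ N'.+1)%MM)); rewrite raddf_sum big_ord_recl /= mcoeff0.
rewrite expr0 mul1r subn0 mcoeffZ mleadcX big1 ?addr0 => [/eqP|i _].
  by rewrite mulf_eq0 expf_eq0 mleadc_eq0 (negbTE q0) andbF orbF => /eqP.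
rewrite mcoeffZ mcoeff_gt_mlead ?mulr0 // mleadM ?expf_neq0 // !mleadX //.
rewrite [X in (_ < X)%O](_ : _ = (mlead q *+ i.+1 + mlead q *+ (N'.+1 - i.+1))%MM); last first.
  by apply/mnmP=> t; rewrite mnmDE !mulmnE -mulnDr subnKC // ltnS; apply: ltnW.
rewrite ltmc_add2l /bump leq0n add1n; elim: (i : nat) => [|m IH]; first by rewrite !mulm1n.
by rewrite mulmS [X in (_ < X)%O]mulmS; apply: ltm_add.
Qed.

(** The numerator and the denominator of x have the same leading monomial, by the
    previous lemma for x and its inverse; subtracting from x the quotient of the
    leading coefficients must then give 0. *)
Lemma algebraic_constant (x : ratfield K n) : alg x -> exists c, x = iota c.
Proof.
have [-> _|x0] := eqVneq x 0; first by exists 0; rewrite rmorph0.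
move=> ax; pose p := \n_(repr x); pose q := \d_(repr x).
have Ex : x = tofrac p / tofrac q by apply: frac_repr.
have q0 : q != 0 by apply: frac_denom.
have p0 : p != 0 by apply: contra_neq x0 => p0; rewrite Ex p0 rmorph0 mul0r.
have pq : mlead p = mlead q.
  have := algebraic_mlead p0 q0; rewrite -Ex => /(_ ax).
  have := algebraic_mlead q0 p0; rewrite -invf_div -Ex => /(_ (algebraic_inv ax)).
  by case: Order.TotalTheory.ltgtP.
pose c := mleadc p / mleadc q.
have lq : mleadc q != 0 by rewrite mleadc_eq0.
exists c; apply/eqP; rewrite -subr_eq0; apply: contrapT => /negP xc.
have Exc : x - iota c = tofrac (p - c *: q) / tofrac q.
  by rewrite -mul_mpolyC tofracB tofracM mulrBl -Ex mulfK ?tofrac_eq0.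
have r0 : p - c *: q != 0.
  by apply: contraNneq xc => r0; rewrite Exc r0 rmorph0 mul0r.
have := algebraic_sub ax (algebraic_id iota c); rewrite Exc => /(algebraic_mlead r0 q0).
case/negP; rewrite Order.POrderTheory.lt_def; apply/andP; split.
  apply/eqP => E; have : mleadc (p - c *: q) != 0 by rewrite mleadc_eq0.
  by rewrite -E mcoeffB mcoeffZ -{1}pq /c divfK // subrr eqxx.
have c0 : c != 0 by rewrite mulf_neq0 ?invr_eq0 ?mleadc_eq0.
by apply: Order.POrderTheory.le_trans (mleadB_le _ _) _; rewrite mleadZ // pq Order.JoinTheory.joinxx.
Qed.
End ConstantField.

(** The generators of a compression of dimension 0 are constants, hence fixed. *)
Lemma ed_le0_trivial (K : fieldType) gT : ed_le K gT 0 -> forall g : gT, g = 1%g.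
Proof.
move=> [n [r [fr [s [t [ss ds st]]]]]] g; apply/eqP; apply: contrapT => /negP g1.
have [x xs] := ds g (lin_action_faithful fr g1).
suff [c ->] : exists c, x = ratfield_const K n c by rewrite act_iota eqxx.
apply: algebraic_constant.
have [|y [[]//]|P [P0 Px]] := algebraic_clear (phi := ratfield_const K n) _ _ (st x xs).
  by move=> c; exists c.
by exists P => //; apply: contra_neq P0 => ->; rewrite rmorph0.
Qed.

Section EdValue.
Variables (K : fieldType) (gT : finGroupType) (G : {group gT}).

Definition subg_rep n (rG : mx_representation K G n) : linrep (subg_of G) K n :=
  @Linrep _ _ _ (fun u => rG (sgval u)) (repr_mx1 rG)
    (fun u v => repr_mxM rG (subgP u) (subgP v)).

Lemma subg_rep_faithful n (rG : mx_representation K G n) :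
  mx_faithful rG -> lin_faithful (subg_rep rG).
Proof.
move=> fr u u1; apply: val_inj; apply: (mx_faithful_inj fr); rewrite ?subgP //.
by rewrite repr_mx1.
Qed.

Lemma fixed_ratfieldE n (rG : mx_representation K G n) :
  fixed_ratfield rG = fixed (lin_action (subg_rep rG)).
Proof.
apply/seteqP; split=> f h g; first by rewrite lin_actionE; apply/h/subgP.
by move=> gG; have := h (subg G g); rewrite lin_actionE /= subgK.
Qed.

(** The value is computed on one representation V0, chosen by [ed]; a compression
    in another representation is transferred to V0. If V0 has dimension 0 the
    fixed field may be finite, but then the group is trivial. *)
Lemma edP : ed_le K (subg_of G) (ed K G) /\
  forall d, ed_le K (subg_of G) d -> (ed K G <= d)%N.
Proof.
rewrite /ed; case: xgetP => [d _ [n [rG [fr]]]|nex].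
  have ff := lin_action_faithful (subg_rep_faithful fr).
  rewrite fixed_ratfieldE => /(ed_extP _ ff)[cd dmin].
  split; first by exists n, (subg_rep rG); split=> //; apply: subg_rep_faithful.
  move=> e ed; apply: dmin.
  case: n rG fr ff {cd} => [|n] rG fr ff; last first.
    by apply: ed_le_transfer ed ff _; apply: infinite_fixed_linear.
  by apply: compressible_trivial => g; apply: (subg_rep_faithful fr); apply/matrixP => -[].
exfalso; pose rG := regular_repr K G.
have fr : mx_faithful rG := regular_mx_faithful K G.
have ff := lin_action_faithful (subg_rep_faithful fr).
have exd : exists d, `[< compressible (lin_action (subg_rep rG)) d >].
  by exists #|G|; apply/asboolP/compressible_dim.
case: (ex_minnP exd) => d /asboolP cd dmin; apply: (nex d).
exists #|G|, rG; split=> //; rewrite fixed_ratfieldE; apply/(ed_extP _ ff); split=> // e ce.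
by apply: dmin; apply/asboolP.
Qed.
End EdValue.

(** * Upper bounds from configurations of points *)

Section PermutedPoints.
Variables (gT : finGroupType) (K M : fieldType) (iota : {rmorphism K -> M}).
Variables (b : field_action gT iota) (fb : faithful b) (ib : infinite_fixed b).
Variables (m : nat) (f : gT -> {perm 'I_m}).
Hypothesis fM : forall x y, f (x * y)%g = (f x * f y)%g.

(** Permutations compose from left to right, hence the inverse in the left action
    on indices. *)
Definition perm_rep g : 'M[K]_m := \matrix_(k, i) (k == (f g)^-1%g i)%:R.

Lemma perm_rep1 : perm_rep 1%g = 1%:M.
Proof.
have f1 : f 1%g = 1%g by apply: (mulgI (f 1%g)); rewrite -fM !mulg1.
by apply/matrixP=> k i; rewrite !mxE f1 invg1 perm1.
Qed.

Lemma perm_repM g h : perm_rep (g * h)%g = perm_rep g *m perm_rep h.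
Proof.
apply/matrixP=> k i; rewrite !mxE (bigD1 ((f h)^-1%g i)) //= !mxE eqxx mulr1.
rewrite big1 ?addr0 => [|l /negbTE li]; last by rewrite !mxE li mulr0.
by rewrite fM invMg permM.
Qed.

(** A generic equivariant point of the permutation representation; the factor V of
    the polynomial to avoid makes its coordinates distinct. *)
Lemma permuted_points (q : {mpoly K[m]}) : q != 0 ->
  exists2 y : 'I_m -> M, (forall g i, b g (y i) = y ((f g)^-1%g i)) &
    injective y /\ mmap iota y q != 0.
Proof.
move=> q0.
pose V : {mpoly K[m]} := \prod_i \prod_(j | j != i) ('X_i - 'X_j).
have V0 : V != 0.
  apply/prodf_neq0 => i _; apply/prodf_neq0 => j ji; rewrite subr_eq0.
  apply/eqP => /(congr1 (mcoeff U_(i))) /eqP.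
  by rewrite !mcoeffXU eqxx (negbTE ji) oner_eq0.
have [y ey] := generic_point fb ib (Linrep perm_rep1 perm_repM) (mulf_neq0 V0 q0).
rewrite rmorphM mulf_eq0 negb_or => /andP[yV yq]; exists y; last split=> //.
  move=> g i; rewrite ey (bigD1 ((f g)^-1%g i)) //= mxE eqxx rmorph1 mul1r.
  by rewrite big1 ?addr0 // => k /negbTE ki; rewrite mxE ki rmorph0 mul0r.
move=> i j yij; apply/eqP; apply: contraTT yV => ij; apply/negPn/eqP.
rewrite rmorph_prod (bigD1 i) //= rmorph_prod (bigD1 j) 1?eq_sym //=.
by rewrite rmorphB /= !mmapX !mmap1U yij subrr !mul0r.
Qed.

End PermutedPoints.

(** Ratios of differences are invariant under affine maps. *)
Lemma affine_ratio (E : fieldType) (u v w o d : E) : d != 0 ->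
  (u - v) / (w - v) = ((u - o) / d - (v - o) / d) / ((w - o) / d - (v - o) / d).
Proof.
move=> d0; have sub x z : (x - o) / d - (z - o) / d = (x - z) / d.
  by rewrite -mulrBl opprB addrA subrK.
by rewrite !sub invf_div mulrA divfK.
Qed.

(** The ratios z i j k of three points of a line are permuted by the group, and
    normalizing two of the points to 0 and 1 shows that they are rational
    functions of one of them. An element acting as a 3-cycle maps a ratio z to a
    Moebius transform of order 3, whose fixed points are excluded by D <> 0. *)
Lemma ed_le_three (K : fieldType) (gT : finGroupType) (f : gT -> {perm 'I_3}) :
  (forall x y, f (x * y)%g = (f x * f y)%g) -> injective f ->
  (forall x : gT, (x ^+ 3)%g = 1%g) -> ed_le K gT 1.
Proof.
move=> fM fi x3.
have f1 : f 1%g = 1%g by apply: (mulgI (f 1%g)); rewrite -fM !mulg1.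
have fX g k : f (g ^+ k)%g = (f g ^+ k)%g.
  by elim: k => [|k IH]; rewrite ?expg0 ?f1 // !expgS fM IH.
have [n [r fr]] := faithful_linrep_exists K gT.
exists n.+1, r; split=> //.
(* the numerator of z i j k - z j k i *)
pose D (R : comNzRingType) (i j k : R) :=
  i ^+ 2 + j ^+ 2 + k ^+ 2 - i * j - i * k - j * k.
pose q : {mpoly K[3]} :=
  \prod_i \prod_(j | j != i) \prod_(k | (k != i) && (k != j)) D _ 'X_i 'X_j 'X_k.
have q0 : q != 0.
  apply/prodf_neq0 => i _; apply/prodf_neq0 => j ji; apply/prodf_neq0 => k /andP[ki kj].
  apply/eqP => /(congr1 (meval (fun l => (l == i)%:R))) /eqP.
  rewrite /D !(rmorphB, rmorphD, rmorphXn, rmorphM) /= !mevalXU rmorph0.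
  rewrite eqxx (negbTE ji) (negbTE ki) expr1n expr0n /= !(mulr0, mul0r, subr0, addr0).
  by rewrite oner_eq0.
have [y ey [yi yq]] := permuted_points (lin_action_faithful fr)
  (infinite_fixed_linear r) fM q0.
have yD i j k : j != i -> k != i -> k != j -> D _ (y i) (y j) (y k) != 0.
  move=> ji ki kj; apply: contraNneq yq => D0.
  rewrite /q rmorph_prod (bigD1 i) //= rmorph_prod (bigD1 j) //= rmorph_prod.
  rewrite (bigD1 k) /= ?ki ?kj // -[X in X * _ * _ * _](_ : D _ (y i) (y j) (y k) = _).
    by rewrite D0 !mul0r.
  by rewrite /D !(rmorphB, rmorphD, rmorphXn, rmorphM) /= !mmapX !mmap1U.
pose z i j k := (y i - y j) / (y k - y j).
have zg g i j k : lin_action r g (z i j k) = 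
    z ((f g)^-1%g i) ((f g)^-1%g j) ((f g)^-1%g k).
  by rewrite /z fmorph_div !rmorphB /= !ey.
pose i0 : 'I_3 := ord0; pose i1 : 'I_3 := inord 1; pose i2 : 'I_3 := inord 2.
apply: (@compressible_of_stable _ _ _ _ (lin_action r)
  [set w | exists i j k, w = z i j k] 1 (fun=> z i0 i1 i2)).
- by exists i0, i0, i0; rewrite /z subrr mul0r.
- by move=> g _ [i [j [k ->]]]; rewrite zg; do 3!eexists.
- move=> g [x gx].
  pose s := (f g)^-1%g.
  have s3 i : s (s (s i)) = i.
    have : (s ^+ 3)%g = 1%g.
      by rewrite /s expgVn -fX x3 f1 invg1.
    by move/(congr1 (fun p : {perm 'I_3} => p i)); rewrite perm1 !expgS expg0 mulg1 !permM.
  have [i si] : exists i, s i != i.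
    apply: contrapT => ns; move/negP: gx; apply.
    suff -> : g = 1%g by rewrite act1.
    apply: fi; apply: invg_inj; apply/permP => i; apply: contrapT => /eqP si.
    apply: ns; exists i; apply: contra_neq si; rewrite -/s => ->.
    by rewrite f1 invg1 perm1.
  have kj : s (s i) != s i by rewrite (inj_eq perm_inj).
  have ki : s (s i) != i by apply: contra_neq si => E; rewrite -[RHS]s3 E.
  exists (z i (s i) (s (s i))); first by do 3!eexists.
  rewrite zg -/s s3; apply: contra_neq (yD i (s i) (s (s i)) si ki kj).
  have nz u v : u != v -> y u - y v != 0 by rewrite subr_eq0 (inj_eq yi).
  move/eqP; rewrite eqr_div ?nz // 1?eq_sym // => /eqP E.
  rewrite /D; transitivity ((y i - y (s i)) * (y i - y (s (s i))) -
     (y (s i) - y (s (s i))) * (y (s (s i)) - y (s i))); first by ring.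
  by rewrite E subrr.
- move=> _ [i [j [k ->]]].
  have sF := subfield_gen (ratfield_const K n.+1) (range (fun _ : 'I_1 => z i0 i1 i2)).
  apply: (algebraic_base sF).
  pose w i := (y i - y i1) / (y i2 - y i1).
  have d0 : y i2 - y i1 != 0.
    by rewrite subr_eq0 (inj_eq yi) -val_eqE /= !inordK.
  have -> : z i j k = (w i - w j) / (w k - w j).
    exact: affine_ratio.
  have wF l : field_gen (ratfield_const K n.+1) (range (fun _ : 'I_1 => z i0 i1 i2)) (w l).
    have [->|l0] := eqVneq l i0; first by apply: sub_gen; exists ord0.
    have [->|l1] := eqVneq l i1; first by rewrite /w subrr mul0r; apply: (sf0 sF).
    suff -> : l = i2 by rewrite /w divff //; apply: (sf1 sF).
    apply/val_inj; rewrite /= inordK //; move: l0 l1; rewrite -!val_eqE /= inordK //.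
    by case: l => [[|[|[|]]]].
  by apply: (sfM sF); [apply: (sfB sF)|apply: (sfV sF); apply: (sfB sF)].
Qed.

Definition cross_ratio (E : fieldType) (I : Type) (y : I -> E) i j k l :=
  ((y i - y k) * (y j - y l)) / ((y i - y l) * (y j - y k)).

Definition i5 (k : nat) : 'I_5 := inord k.

Lemma i5_val (k : nat) : (k < 5)%N -> i5 k = k :> nat.
Proof. exact: inordK. Qed.

Lemma i5P (P : 'I_5 -> Prop) :
  P (i5 0) -> P (i5 1) -> P (i5 2) -> P (i5 3) -> P (i5 4) -> forall i, P i.
Proof.
have H k (i : 'I_5) : i = k :> nat -> P (i5 k) -> P i.
  by move=> E; rewrite (_ : i = i5 k) //; apply: val_inj; rewrite /= i5_val -?E.
move=> h0 h1 h2 h3 h4 i; have := ltn_ord i.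
case E: (i : nat) => [|[|[|[|[|k]]]]] // _; exact: H E _.
Qed.

(** Five points of the projective line can be normalized to infinity, 0, 1, u, v,
    and then all cross-ratios are rational functions of u and v. The normalizing
    map sends (y s, 1) to (A s, B s) = nu s (u s, v s), so it multiplies the
    differences y s - y t, which are 2 x 2 determinants, by dt, and the scalars nu
    and dt cancel in cross-ratios. *)
Lemma cross_ratio_generated (K L : fieldType) (iota : {rmorphism K -> L}) (F : set L)
    (sF : subfield_over iota F) (y : 'I_5 -> L) : injective y ->
  F (cross_ratio y (i5 3) (i5 2) (i5 1) (i5 0)) ->
  F (cross_ratio y (i5 4) (i5 2) (i5 1) (i5 0)) ->
  forall i j k l, F (cross_ratio y i j k l).
Proof.
move=> yi F3 F4 i j k l.
have nz s t : (s < 5)%N -> (t < 5)%N -> s != t -> y (i5 s) - y (i5 t) != 0.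
  by move=> s5 t5 st; rewrite subr_eq0 (inj_eq yi) -val_eqE /= !i5_val.
pose A s := (y (i5 2) - y (i5 0)) * (y s - y (i5 1)).
pose B s := (y (i5 2) - y (i5 1)) * (y s - y (i5 0)).
pose nu s := if s == i5 0 then A s else B s.
pose u s := if s == i5 0 then 1 else A s / B s.
pose v (s : 'I_5) : L := (s != i5 0)%:R.
pose e s t := u s * v t - u t * v s.
have B0 s : s != i5 0 -> B s != 0.
  by move=> s0; rewrite mulf_neq0 ?nz // subr_eq0 (inj_eq yi).
have nu0 s : nu s != 0.
  rewrite /nu; case: (eqVneq s (i5 0)) => [->|/B0 //].
  by rewrite mulf_neq0 ?nz.
have EA s : A s = nu s * u s.
  rewrite /nu /u; case: (eqVneq s (i5 0)) => [_|/B0 s0]; first by rewrite mulr1.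
  by rewrite mulrCA mulfV ?mulr1.
have EB s : B s = nu s * v s.
  rewrite /nu /v; case: (eqVneq s (i5 0)) => [->|_] /=; last by rewrite mulr1.
  by rewrite /B subrr !mulr0.
pose dt := (y (i5 2) - y (i5 0)) * (y (i5 2) - y (i5 1)) * (y (i5 1) - y (i5 0)).
have dt0 : dt != 0 by rewrite !mulf_neq0 ?nz.
have det s t : dt * (y s - y t) = nu s * nu t * e s t.
  transitivity (A s * B t - A t * B s); first by rewrite /A /B /dt; ring.
  by rewrite !EA !EB /e; ring.
have Fu s : F (u s).
  have [->|s0] := eqVneq s (i5 0); first by rewrite /u eqxx; apply: (sf1 sF).
  rewrite /u (negbTE s0); move: s s0; apply: i5P => [|_|_|_|_].
  - by rewrite eqxx.
  - by rewrite /A subrr mulr0 mul0r; apply: (sf0 sF).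
  - have -> : A (i5 2) = B (i5 2) by exact: mulrC.
    rewrite divff; first exact: (sf1 sF).
    by apply: B0; rewrite -val_eqE /= !i5_val.
  - move: F3; rewrite /cross_ratio /A /B.
    by rewrite [X in X / _]mulrC [X in _ / X]mulrC.
  - move: F4; rewrite /cross_ratio /A /B.
    by rewrite [X in X / _]mulrC [X in _ / X]mulrC.
have Fv s : F (v s) by rewrite /v; case: (_ != _); [apply: (sf1 sF)|apply: (sf0 sF)].
have Fe s t : F (e s t) by apply: (sfB sF); apply: (sfM sF).
suff -> : cross_ratio y i j k l = (e i k * e j l) / (e i l * e j k).
  by apply: (sfM sF); [apply: (sfM sF)|apply: (sfV sF); apply: (sfM sF)].
have c0 : nu i * nu j * nu k * nu l != 0 by rewrite !mulf_neq0.
have d20 : dt ^+ 2 != 0 by rewrite expf_neq0.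
rewrite /cross_ratio -[LHS]mul1r -{1}(divff d20) mulf_div.
rewrite -[RHS]mul1r -{1}(divff c0) mulf_div; congr (_ / _).
  transitivity ((dt * (y i - y k)) * (dt * (y j - y l))); first by ring.
  by rewrite !det; ring.
transitivity ((dt * (y i - y l)) * (dt * (y j - y k))); first by ring.
by rewrite !det; ring.
Qed.

(** The cross-ratios are permuted by the group. The elements fixing all of them
    form a normal subgroup, so by simplicity it suffices that one 3-cycle moves
    one cross-ratio of a generic point. *)
Lemma ed_le_five (K : fieldType) (gT : finGroupType) (f : gT -> {perm 'I_5}) :
  (forall x y, f (x * y)%g = (f x * f y)%g) -> simple [set: gT]%SET ->
  (exists g, let s := (f g)^-1%g in
     [/\ s (i5 0) = i5 0, s (i5 1) = i5 1, s (i5 2) = i5 3 & s (i5 3) = i5 4]) ->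
  ed_le K gT 2.
Proof.
move=> fM simT [g0 [g00 g01 g02 g03]]; have [n [r fr]] := faithful_linrep_exists K gT.
exists n.+1, r; split=> //.
pose X k : {mpoly K[5]} := 'X_(i5 k).
(* the numerator of the difference of the cross-ratio of points 0, 1, 2, 3 and its
   image under the 3-cycle *)
pose q : {mpoly K[5]} :=
  (X 0%N - X 2%N) * (X 1%N - X 3%N) * ((X 0%N - X 4%N) * (X 1%N - X 3%N)) -
  (X 0%N - X 3%N) * (X 1%N - X 4%N) * ((X 0%N - X 3%N) * (X 1%N - X 2%N)).
(* at X_0 = X_3 = 0 and X_1 = X_2 = X_4 = 1 the value is 1 *)
have q0 : q != 0.
  apply/eqP => /(congr1 (meval (fun l : 'I_5 => ((l != i5 0) && (l != i5 3))%:R))) /eqP.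
  rewrite /q /X !(rmorphB, rmorphM) /= !mevalXU rmorph0 -!val_eqE /= !i5_val //=.
  by rewrite !(subrr, mul0r, mulr0, sub0r, subr0, mulr1, mul1r, mulrNN) oner_eq0.
have [y ey [yi yq]] := permuted_points (lin_action_faithful fr)
  (infinite_fixed_linear r) fM q0.
have cg g i j k l : lin_action r g (cross_ratio y i j k l) =
    cross_ratio y ((f g)^-1%g i) ((f g)^-1%g j) ((f g)^-1%g k) ((f g)^-1%g l).
  by rewrite /cross_ratio fmorph_div !rmorphM !rmorphB /= !ey.
pose S := [set w | exists i j k l, w = cross_ratio y i j k l].
have stS : stable (lin_action r) S.
  by move=> g _ [i [j [k [l ->]]]]; rewrite cg; do 4!eexists.
pose t (o : 'I_2) := if o == ord0 then cross_ratio y (i5 3) (i5 2) (i5 1) (i5 0)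
  else cross_ratio y (i5 4) (i5 2) (i5 1) (i5 0).
apply: (@compressible_of_stable _ _ _ _ (lin_action r) S 2 t) => //.
- by exists (i5 0), (i5 0), (i5 0), (i5 0); rewrite /cross_ratio subrr !mul0r.
- move=> g [x gx]; apply: contrapT => ng.
  pose N := [set h | `[< forall w, S w -> lin_action r h w = w >]]%SET.
  have NP h : reflect (forall w, S w -> lin_action r h w = w) (h \in N).
    by rewrite finset.inE; apply: asboolP.
  have gN : group_set N.
    apply/group_setP; split=> [|h k /NP hh /NP hk]; apply/NP => w Sw.
      by rewrite act1.
    by rewrite actM hk ?hh.
  have nN : (group gN <| [set: gT]%SET)%g.
    apply/normalP; split; first exact: finset.subsetT.
    move=> h _; apply/eqP; rewrite eqEcard cardJg leqnn andbT.
    apply/fintype.subsetP => _ /imsetP[k /NP hk ->]; apply/NP => w Sw.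
    by rewrite /conjg !actM hk -?actM ?mulVg ?act1 //; apply: stS.
  have gN' : g \in N.
    apply/NP => w Sw; apply: contrapT => /eqP gw; apply: ng; by exists w.
  have [_ /(_ _ nN)[N1|NT]] := simpleP _ simT.
    by move: gN'; rewrite [N]N1 => /set1gP g1; rewrite g1 act1 eqxx in gx.
  have /NP/(_ (cross_ratio y (i5 0) (i5 1) (i5 2) (i5 3))) : g0 \in N.
    by rewrite [N]NT finset.inE.
  rewrite cg g00 g01 g02 g03 => H; have {H} : S _ -> _ := H.
  have Sx : S (cross_ratio y (i5 0) (i5 1) (i5 2) (i5 3)) by do 4!eexists.
  move=> /(_ Sx) /eqP; rewrite /cross_ratio.
  have nz u v : (u < 5)%N -> (v < 5)%N -> u != v -> y (i5 u) - y (i5 v) != 0.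
    by move=> u5 v5 uv; rewrite subr_eq0 (inj_eq yi) -val_eqE /= !i5_val.
  rewrite eqr_div ?mulf_neq0 ?nz // => /eqP E.
  move/eqP: yq; apply; rewrite /q /X !(rmorphB, rmorphM) /= !mmapX !mmap1U.
  by rewrite -E subrr.
- move=> _ [i [j [k [l ->]]]].
  have sF := subfield_gen (ratfield_const K n.+1) (range t).
  apply: (algebraic_base sF); apply: (cross_ratio_generated sF yi).
    by apply: sub_gen; exists ord0.
  by apply: sub_gen; exists ord_max.
Qed.

(** * Permutation groups *)

Lemma sign_rat_inj : injective (fun b : bool => (-1) ^+ b : rat).
Proof. by case=> -[]. Qed.

Section BlockPermutation.
Variables (m k : nat).
Implicit Types (p : 'S_m) (q : 'S_k).

Definition block_fun p q (x : 'I_(m + k)) : 'I_(m + k) :=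
  unsplit (match split x with inl i => inl (p i) | inr j => inr (q j) end).

Lemma block_fun_comp p p' q q' x :
  block_fun p' q' (block_fun p q x) = block_fun (p * p')%g (q * q')%g x.
Proof. by rewrite /block_fun unsplitK; case: split => i; rewrite permM. Qed.

Lemma block_fun1 x : block_fun 1%g 1%g x = x.
Proof. by rewrite /block_fun -[RHS]splitK; case: split => i; rewrite perm1. Qed.

Lemma block_fun_inj p q : injective (block_fun p q).
Proof.
by apply: (can_inj (g := block_fun p^-1%g q^-1%g)) => x;
  rewrite block_fun_comp !mulgV block_fun1.
Qed.

Definition block_perm p q : 'S_(m + k) := perm (@block_fun_inj p q).

Lemma block_permM p p' q q' :
  block_perm (p * p')%g (q * q')%g = (block_perm p q * block_perm p' q')%g.
Proof. by apply/permP=> x; rewrite permM !permE block_fun_comp. Qed.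

Lemma block_perm_inj p p' q q' : block_perm p q = block_perm p' q' -> p = p' /\ q = q'.
Proof.
move=> E; split; apply/permP => i.
  have := congr1 (fun s : 'S_(m + k) => split (s (lshift k i))) E.
  by rewrite !permE /block_fun (unsplitK (inl i)) !unsplitK => -[].
have := congr1 (fun s : 'S_(m + k) => split (s (rshift m i))) E.
by rewrite !permE /block_fun (unsplitK (inr i)) !unsplitK => -[].
Qed.

(** The sign is the determinant of the permutation matrix, here block diagonal. *)
Lemma odd_block_perm p q : odd_perm (block_perm p q) = odd_perm p (+) odd_perm q.
Proof.
apply: sign_rat_inj; rewrite signr_addb -!det_perm -(det_ublock _ 0).
congr (\det _); apply/matrixP=> i j.
rewrite -(splitK i) -(splitK j); case: (split i) => i'; case: (split j) => j' /=;
rewrite ?(block_mxEul, block_mxEur, block_mxEdl, block_mxEdr) !mxE permE /block_fun.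
- by rewrite (unsplitK (inl i')) /= (inj_eq (@lshift_inj _ _)).
- by rewrite (unsplitK (inl i')) /= eq_lrshift.
- by rewrite (unsplitK (inr i')) /= eq_rlshift.
- by rewrite (unsplitK (inr i')) /= (inj_eq (@rshift_inj _ _)).
Qed.

End BlockPermutation.

Notation altT n := (subg_of 'Alt_('I_n)).

Lemma alt_even n (u : altT n) : odd_perm (sgval u) = false.
Proof. by have := subgP u; rewrite Alt_even => /negbTE. Qed.

Lemma ed_le_alt_hom (K : fieldType) (gT : finGroupType) n (f : gT -> 'S_n) d :
  (forall x y, f (x * y)%g = (f x * f y)%g) -> injective f ->
  (forall x, odd_perm (f x) = false) ->
  ed_le K (altT n) d -> ed_le K gT d.
Proof.
move=> fM fi fe; have fA x : f x \in ('Alt_('I_n))%G by rewrite /= Alt_even fe.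
apply: (@ed_le_hom _ _ _ (fun x => subg ('Alt_('I_n))%G (f x))) => x y.
  by apply: val_inj; rewrite /= fM !subgK ?groupM.
by move=> /(congr1 (@sgval _ _)); rewrite !subgK // => /fi.
Qed.

Lemma ed_le_altW (K : fieldType) m n d : (m <= n)%N ->
  ed_le K (altT n) d -> ed_le K (altT m) d.
Proof.
move=> mn; rewrite -(subnKC mn).
apply: (@ed_le_alt_hom _ _ _ (fun u : altT m => block_perm (sgval u) 1%g)) => [x y|x y|x].
- by rewrite -block_permM mulg1.
- by move=> /block_perm_inj[/val_inj].
- by rewrite odd_block_perm alt_even odd_perm1.
Qed.

Lemma simple_altT n : (5 <= n)%N -> simple [set: altT n]%SET.
Proof.
move=> n5; rewrite -(isog_simple (isog_subg ('Alt_('I_n))%G)).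
by apply: simple_Alt5; rewrite card_ord.
Qed.

Lemma sol_altT n : (5 <= n)%N -> solvable [set: altT n]%SET = false.
Proof.
move=> n5; rewrite -(isog_sol (isog_subg ('Alt_('I_n))%G)).
by apply: solvable_AltF; rewrite card_ord.
Qed.

(** The condition under which a central factor of order p raises the essential
    dimension. *)
Definition sol_exponent (gT : finGroupType) p :=
  forall N : {group gT}, (N <| [set: gT]%SET)%g -> solvable N ->
    forall x, x \in N -> (x ^+ p)%g = 1%g.

(** The image in A_n of a solvable normal subgroup is solvable and normal, hence
    trivial. *)
Lemma sol_exponent_alt (gT : finGroupType) n p (f : gT -> altT n) : (5 <= n)%N ->
  (forall x y, f (x * y)%g = (f x * f y)%g) -> (forall u, exists x, f x = u) ->
  (forall x, f x = 1%g -> (x ^+ p)%g = 1%g) -> sol_exponent gT p.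
Proof.
move=> n5 fM fs fk N nN sN x xN; apply: fk.
have fM' : {in setT_group gT &, {morph f : x y / (x * y)%g}} by move=> ? ? _ _; apply: fM.
pose phi : {morphism setT_group gT >-> altT n} := Morphism fM'.
have sub : N \subset setT_group gT by apply: finset.subsetT.
have : (phi @* N <| phi @* setT_group gT)%g by apply: morphim_normal.
have -> : (phi @* setT_group gT)%g = [set: altT n]%SET.
  apply/setP => u; rewrite finset.inE; have [y <-] := fs u.
  by apply: mem_morphim; rewrite finset.inE.
have [_ simp] := simpleP _ (simple_altT n5).
move=> /simp[P1|PT].
  have : phi x \in (phi @* N)%g by apply: mem_morphim => //; rewrite finset.inE.
  by rewrite P1 => /set1gP.
by have := morphim_sol phi sN; rewrite PT sol_altT.
Qed.

Lemma sol_exponentW (gT : finGroupType) p :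
  (forall x : gT, (x ^+ p)%g = 1%g) -> sol_exponent gT p.
Proof. by move=> h N _ _ x _. Qed.

Lemma prod_expg (gT hT : finGroupType) (x : gT * hT) n :
  (x ^+ n)%g = ((x.1 ^+ n)%g, (x.2 ^+ n)%g).
Proof. by elim: n => [|n IH]; rewrite ?expg0 // !expgS IH. Qed.

Lemma Zp_exp p (z : 'Z_p.+2) : (z ^+ p.+2)%g = 1%g.
Proof.
by have := @expg_cardG _ (setT_group 'Z_p.+2) z (finset.in_setT z);
  rewrite finset.cardsT card_ord.
Qed.

(** Faithful characters of Z/p, written with p + 2 for the modulus since this is
    how the type of integers mod p is indexed. *)
Section ZpCharacter.
Variables (K : fieldType) (p : nat) (zeta : K).
Hypotheses (zp : zeta ^+ p.+2 = 1) (z1 : zeta != 1) (pp : prime p.+2).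

Definition zchar (z : 'Z_p.+2) : K := zeta ^+ z.

Lemma zcharM x y : zchar (x * y)%g = zchar x * zchar y.
Proof. by rewrite /zchar -exprD -(expr_mod (x + y)%N zp). Qed.

Lemma zchar0 x : zchar x != 0.
Proof. by rewrite expf_neq0 //; apply/eqP=> z0; move/eqP: zp; rewrite z0 expr0n eq_sym oner_eq0. Qed.

Lemma zchar1 x : zchar x = 1 -> x = 1%g.
Proof.
move=> x1; apply: val_inj => /=; apply/eqP; apply: contraNT z1 => x0.
have cop : coprime x p.+2.
  rewrite coprime_sym prime_coprime // gtnNdvd // ?lt0n //; exact: ltn_ord.
have x_gt0 : (0 < x)%N by rewrite lt0n.
case: (egcdnP p.+2 x_gt0) => u v; rewrite (eqP cop) => E _; move/(congr1 (fun i => zeta ^+ i)): E.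
by rewrite mulnC exprM [zeta ^+ x]x1 expr1n addn1 exprS mulnC exprM zp expr1n mulr1 => <-.
Qed.
End ZpCharacter.

Lemma Zp_neq1 p : exists c : 'Z_p.+2, c != 1%g.
Proof. by exists (inord 1); rewrite -val_eqE /= inordK. Qed.

Lemma ed_le_Zp (K : fieldType) (gT : finGroupType) p (zeta : K) d :
  prime p.+2 -> p.+2%:R != 0 :> K -> zeta ^+ p.+2 = 1 -> zeta != 1 ->
  sol_exponent (gT * 'Z_p.+2)%type p.+2 ->
  ed_le K (gT * 'Z_p.+2)%type d -> exists2 e, d = e.+1 & ed_le K gT e.
Proof.
move=> pp pK zp z1 solp; apply: (ed_le_prod (chi := zchar zeta) (p := p.+2)) => //.
- exact: zcharM.
- exact: zchar0.
- exact: zchar1.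
- exact: Zp_neq1.
Qed.

(** Translations of Z/3; they are even, being squares. *)
Definition rot3 (z : 'Z_3) : 'S_3 := perm (@addIr 'Z_3 z).

Lemma rot3M x y : rot3 (x * y)%g = (rot3 x * rot3 y)%g.
Proof. by apply/permP=> i; rewrite permM !permE /= addrA. Qed.

Lemma rot3_inj : injective rot3.
Proof.
by move=> x y /(congr1 (fun s : 'S_3 => s 0)); rewrite !permE !add0r.
Qed.

Lemma rot3_even z : odd_perm (rot3 z) = false.
Proof.
rewrite (_ : z = (z ^+ 2 * z ^+ 2)%g); last first.
  by rewrite -expgD [(z ^+ (2 + 2))%g](expgD z 3 1) Zp_exp mul1g expg1.
by rewrite rot3M odd_permM addbb.
Qed.

(** The two involutions are disjoint products of transpositions, so the group that
    they generate is even and commutative. *)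
Definition klein1 : 'S_4 := (tperm (inord 0) (inord 1) * tperm (inord 2) (inord 3))%g.
Definition klein2 : 'S_4 := (tperm (inord 0) (inord 2) * tperm (inord 1) (inord 3))%g.

Lemma ord4P (P : 'I_4 -> Prop) :
  P (inord 0) -> P (inord 1) -> P (inord 2) -> P (inord 3) -> forall i, P i.
Proof.
have H k (i : 'I_4) : i = k :> nat -> P (inord k) -> P i.
  by move=> E; rewrite (_ : i = inord k) //; apply: val_inj; rewrite /= inordK -?E.
move=> h0 h1 h2 h3 i; have := ltn_ord i.
case E: (i : nat) => [|[|[|[|k]]]] // _; exact: H E _.
Qed.

Lemma inord4_eq a b : (a < 4)%N -> (b < 4)%N -> (inord a == inord b :> 'I_4) = (a == b).
Proof. by move=> a4 b4; rewrite -val_eqE /= !inordK. Qed.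

Lemma klein1E : [/\ klein1 (inord 0) = inord 1, klein1 (inord 1) = inord 0,
  klein1 (inord 2) = inord 3 & klein1 (inord 3) = inord 2].
Proof. by split; rewrite permM !permE /= !inord4_eq //= !permE /= !inord4_eq. Qed.

Lemma klein2E : [/\ klein2 (inord 0) = inord 2, klein2 (inord 1) = inord 3,
  klein2 (inord 2) = inord 0 & klein2 (inord 3) = inord 1].
Proof. by split; rewrite permM !permE /= !inord4_eq //= !permE /= !inord4_eq. Qed.

Definition klein (x y : 'Z_2) : 'S_4 := (klein1 ^+ x * klein2 ^+ y)%g.

Lemma klein_comm : commute klein1 klein2.
Proof.
have [a0 a1 a2 a3] := klein1E; have [b0 b1 b2 b3] := klein2E.
by apply/permP; apply: ord4P; rewrite permM [RHS]permM !(a0, a1, a2, a3, b0, b1, b2, b3).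
Qed.

Lemma klein1_sq : (klein1 ^+ 2)%g = 1%g.
Proof.
have [a0 a1 a2 a3] := klein1E.
by apply/permP; apply: ord4P; rewrite expgS expg1 permM perm1 !(a0, a1, a2, a3).
Qed.

Lemma klein2_sq : (klein2 ^+ 2)%g = 1%g.
Proof.
have [a0 a1 a2 a3] := klein2E.
by apply/permP; apply: ord4P; rewrite expgS expg1 permM perm1 !(a0, a1, a2, a3).
Qed.

Lemma kleinM x x' y y' : klein (x * x')%g (y * y')%g = (klein x y * klein x' y')%g.
Proof.
have E (s : 'S_4) (u v : 'Z_2) : (s ^+ 2 = 1 -> s ^+ (u * v)%g = s ^+ u * s ^+ v)%g.
  by move=> s2; rewrite -expgD -(expg_mod (u + v)%N s2).
rewrite /klein !E ?klein1_sq ?klein2_sq // -!mulgA; congr (_ * _)%g.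
by rewrite !mulgA; congr (_ * _)%g; apply: commuteX2; apply: klein_comm.
Qed.

Lemma klein_inj x x' y y' : klein x y = klein x' y' -> x = x' /\ y = y'.
Proof.
have [a0 a1 a2 a3] := klein1E; have [b0 b1 b2 b3] := klein2E.
have H (u v : 'Z_2) : klein u v (inord 0) = inord (u + 2 * v).
  rewrite /klein permM.
  case: u => [[|[|//]] hu]; case: v => [[|[|//]] hv] /=;
    by rewrite ?expg0 ?expg1 ?perm1 ?a0 ?b0 ?b1.
move=> /(congr1 (fun s : 'S_4 => s (inord 0))); rewrite !H => /eqP.
have lt4 (u v : 'Z_2) : (u + 2 * v < 4)%N by case: u => [[|[|//]] hu]; case: v => [[|[|//]] hv].
rewrite inord4_eq //.
case: x => [[|[|//]] hx]; case: y => [[|[|//]] hy]; case: x' => [[|[|//]] hx'];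
  case: y' => [[|[|//]] hy'] //= _; split; exact: val_inj.
Qed.

Lemma klein_even x y : odd_perm (klein x y) = false.
Proof.
have H (s : 'S_4) (u : 'Z_2) : odd_perm s = false -> odd_perm (s ^+ u)%g = false.
  by move=> s0; elim: (u : nat) => [|k IH]; rewrite ?expg0 ?odd_perm1 // expgS odd_permM s0 IH.
by rewrite odd_permM !H // odd_permM !odd_tperm !inord4_eq.
Qed.

(** * Essential dimension of the alternating groups *)

Lemma altT_le2 n (u : altT n) : (n <= 2)%N -> u = 1%g.
Proof.
move=> n2; apply: val_inj => /=; apply/set1gP.
by rewrite -(@trivial_Alt_2 'I_n) ?card_ord // (subgP u).
Qed.

Lemma altT3_exp (u : altT 3) : (u ^+ 3)%g = 1%g.
Proof.
have := @expg_cardG _ ('Alt_('I_3))%G (sgval u) (subgP u).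
have -> : #|('Alt_('I_3))%g| = 3%N.
  have := @card_Alt 'I_3; rewrite card_ord => /(_ isT).
  by rewrite (_ : 3`! = 2 * 3)%N // => /eqP; rewrite eqn_pmul2l // => /eqP.
have EX k : sgval (u ^+ k)%g = (sgval u ^+ k)%g.
  by elim: k => [|k IH]; rewrite ?expg0 // !expgS /= IH.
by move=> u3; apply: val_inj; exact: etrans (EX 3%N) u3.
Qed.

Lemma prod_exp (gT hT : finGroupType) p :
  (forall x : gT, (x ^+ p)%g = 1%g) -> (forall x : hT, (x ^+ p)%g = 1%g) ->
  forall x : gT * hT, (x ^+ p)%g = 1%g.
Proof. by move=> h1 h2 x; rewrite prod_expg h1 h2. Qed.

Section StepThree.
Variables (K : fieldType) (zeta : K).
Hypotheses (z3 : zeta ^+ 3 = 1) (z1 : zeta != 1).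

(** In characteristic 3 the polynomial X^3 - 1 is (X - 1)^3. *)
Lemma three_neq0 : 3%:R != 0 :> K.
Proof.
apply: contra_neq z1 => t0; apply/eqP; rewrite -subr_eq0.
have : (zeta - 1) ^+ 3 = 0.
  transitivity (zeta ^+ 3 - 1 - 3%:R * (zeta ^+ 2 - zeta)); first by ring.
  by rewrite z3 t0 mul0r subrr subr0.
by move/eqP; rewrite expf_eq0.
Qed.

(** For n <= 3 the group A_n x Z/3 has exponent 3; for n >= 5 simplicity of A_n
    applies. *)
Lemma ed_le_alt_three n d : n != 4%N -> ed_le K (altT (n + 3)) d ->
  exists2 e, d = e.+1 & ed_le K (altT n) e.
Proof.
move=> n4 /(@ed_le_alt_hom K (altT n * 'Z_3)%type _
    (fun x => block_perm (sgval x.1) (rot3 x.2))) H.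
apply: (ed_le_Zp (isT : prime 3) three_neq0 z3 z1); last first.
  apply: H => [x y|[x y] [x' y']|x].
  - by rewrite -block_permM -rot3M.
  - by move=> /block_perm_inj[/= /val_inj -> /rot3_inj ->].
  - by rewrite odd_block_perm alt_even rot3_even.
case: (leqP n 3) => [n3|n3].
  apply/sol_exponentW/prod_exp; last exact: Zp_exp.
  have [n2|n2] := leqP n 2; first by move=> x; rewrite [x]altT_le2 ?expg1n.
  have E : n = 3%N by apply/eqP; rewrite eqn_leq n3 n2.
  by rewrite E => x; apply: altT3_exp.
apply: (@sol_exponent_alt _ n 3 (fun x => x.1)) => // [|u|[x y] /= ->]; first by lia.
  by exists (u, 1%g).
by rewrite prod_expg /= expg1n Zp_exp.
Qed.
End StepThree.

Section StepFour.
Variable K : fieldType.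
Hypothesis K2 : 2%:R != 0 :> K.

Let sq : (-1 : K) ^+ 2 = 1. Proof. by rewrite sqrrN expr1n. Qed.
Let m1 : (-1 : K) != 1.
Proof. by apply: contra_neq K2 => m1; rewrite mulr2n -{1}m1 addNr. Qed.

Lemma ed_le_Z2 (gT : finGroupType) d : sol_exponent (gT * 'Z_2)%type 2 ->
  ed_le K (gT * 'Z_2)%type d -> exists2 e, d = e.+1 & ed_le K gT e.
Proof. exact: (ed_le_Zp (isT : prime 2) K2 sq m1). Qed.

Definition klein_ext n (x : altT n * 'Z_2 * 'Z_2) : 'S_(n + 4) :=
  block_perm (sgval x.1.1) (klein x.1.2 x.2).

Lemma klein_extM n (x y : altT n * 'Z_2 * 'Z_2) :
  klein_ext (x * y)%g = (klein_ext x * klein_ext y)%g.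
Proof. by rewrite /klein_ext -block_permM -kleinM. Qed.

Lemma klein_ext_inj n : injective (@klein_ext n).
Proof.
by move=> [[u x] y] [[u' x'] y'] /block_perm_inj[/= /val_inj -> /klein_inj[-> ->]].
Qed.

Lemma klein_ext_even n (x : altT n * 'Z_2 * 'Z_2) : odd_perm (klein_ext x) = false.
Proof. by rewrite odd_block_perm alt_even klein_even. Qed.

(** The two factors Z/2 are removed one after the other, each time as a direct
    factor with the sign character. *)
Lemma ed_le_alt_four n d : n != 3%N -> n != 4%N -> ed_le K (altT (n + 4)) d ->
  exists2 e, d = e.+2 & ed_le K (altT n) e.
Proof.
move=> n3 n4 /(ed_le_alt_hom (@klein_extM n) (@klein_ext_inj n) (@klein_ext_even n)).
have solp1 : sol_exponent (altT n * 'Z_2)%type 2 /\ sol_exponent (altT n * 'Z_2 * 'Z_2)%type 2.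
  have [n5|n5] := leqP 5 n.
    split; [apply: (@sol_exponent_alt _ n 2 (fun x => x.1)) => // [u|[x y] /= ->]
           |apply: (@sol_exponent_alt _ n 2 (fun x => x.1.1)) => // [u|[[x y] z] /= ->]].
    - by exists (u, 1%g).
    - by rewrite prod_expg /= expg1n Zp_exp.
    - by exists (u, 1%g, 1%g).
    - by rewrite !prod_expg /= expg1n !Zp_exp.
  have E (u : altT n) : (u ^+ 2)%g = 1%g by rewrite [u]altT_le2 ?expg1n //; lia.
  by split; apply/sol_exponentW; do ![apply: prod_exp|apply: Zp_exp|exact: E].
case: solp1 => s1 s2 /(ed_le_Z2 s2)[e -> /(ed_le_Z2 s1)[e' -> h]].
by exists e'.
Qed.

(** A_4 is solvable and not of exponent 2, so it is replaced by its subgroup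
    (Z/2)^2: the group (Z/2)^4 inside A_8 has exponent 2. *)
Lemma ed_le_alt8 d : ed_le K (altT 8) d -> (4 <= d)%N.
Proof.
pose G4 := (altT 0 * 'Z_2 * 'Z_2)%type.
have f4 (x : G4) : klein_ext x \in ('Alt_('I_(0 + 4)))%G by rewrite /= Alt_even klein_ext_even.
pose f (x : G4 * 'Z_2 * 'Z_2) : altT 4 * 'Z_2 * 'Z_2 :=
  (subg ('Alt_('I_(0 + 4)))%G (klein_ext x.1.1), x.1.2, x.2).
have fM (x y : G4 * 'Z_2 * 'Z_2) : f (x * y)%g = (f x * f y)%g.
  rewrite /f klein_extM; congr (_, _, _).
  by apply: val_inj; rewrite /= !subgK ?groupM.
have fi : injective f.
  move=> [[x y] z] [[x' y'] z'] [] /(congr1 (@sgval _ _)); rewrite /= !subgK //.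
  by move=> E -> ->; rewrite (@klein_ext_inj 0 _ _ E).
move=> /(ed_le_alt_hom (@klein_extM 4) (@klein_ext_inj 4) (@klein_ext_even 4)).
move=> /(ed_le_hom fM fi).
have E0 (u : altT 0) : (u ^+ 2)%g = 1%g by rewrite [u]altT_le2 ?expg1n.
do 4![move=> /ed_le_Z2[|? -> ]; first by apply/sol_exponentW; do ![apply: prod_exp|apply: Zp_exp|exact: E0]].
by [].
Qed.

End StepFour.

Lemma ed_le_alt5 (K : fieldType) : ed_le K (altT 5) 2.
Proof.
apply: (@ed_le_five K _ (fun u : altT 5 => sgval u)) => //; first exact: simple_altT.
pose s : 'S_5 := (tperm (i5 2) (i5 3) * tperm (i5 2) (i5 4))%g.
have sA : s^-1%g \in ('Alt_('I_5))%G.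
  by rewrite /= groupV Alt_even odd_permM !odd_tperm -!val_eqE /= !i5_val.
exists (subg ('Alt_('I_5))%G s^-1%g); rewrite subgK // invgK.
by split; rewrite /s permM !permE /= -!val_eqE /= !i5_val //= !permE /= -!val_eqE /= !i5_val.
Qed.

Lemma ed_le_alt3 (K : fieldType) : ed_le K (altT 3) 1.
Proof.
apply: (@ed_le_three K _ (fun u : altT 3 => sgval u)) => //; first exact: val_inj.
exact: altT3_exp.
Qed.

Lemma ed_AltP (K : fieldType) n : ed_le K (altT n) (ed_Alt K n) /\
  forall d, ed_le K (altT n) d -> (ed_Alt K n <= d)%N.
Proof. exact: edP. Qed.

Lemma ed_Alt_mono (K : fieldType) m n : (m <= n)%N -> (ed_Alt K m <= ed_Alt K n)%N.
Proof. by move=> mn; apply: (ed_AltP K m).2; apply: ed_le_altW mn (ed_AltP K n).1. Qed.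

Lemma ed_Alt3_gt0 (K : fieldType) : (0 < ed_Alt K 3)%N.
Proof.
rewrite lt0n; apply/eqP => e0; have := (ed_AltP K 3).1; rewrite e0 => /ed_le0_trivial t.
have c3 := @card_Alt 'I_3; rewrite card_ord in c3; move: (c3 isT).
have -> : ('Alt_('I_3))%g = 1%g.
  apply/trivgP/fintype.subsetP => x xA; apply/set1gP.
  by have := congr1 (@sgval _ _) (t (subg ('Alt_('I_3))%G x)); rewrite subgK.
by rewrite cards1.
Qed.

Lemma ed_Alt_three (K : fieldType) (zeta : K) n : zeta ^+ 3 = 1 -> zeta != 1 ->
  n != 4%N -> (ed_Alt K n + 1 <= ed_Alt K (n + 3))%N.
Proof.
move=> z3 z1 n4; have [e -> h] := ed_le_alt_three z3 z1 n4 (ed_AltP K (n + 3)).1.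
by rewrite addn1 ltnS; apply: (ed_AltP K n).2.
Qed.

Lemma ed_Alt_third (K : fieldType) (zeta : K) n : zeta ^+ 3 = 1 -> zeta != 1 ->
  (n %/ 3 <= ed_Alt K n)%N.
Proof.
move=> z3 z1; elim/ltn_ind: n => n IH.
have [n3|n3] := ltnP n 3; first by rewrite divn_small.
have step m : m != 4%N -> (m < n)%N -> ((m + 3) %/ 3 <= ed_Alt K (m + 3))%N.
  move=> m4 mn; apply: leq_trans (ed_Alt_three z3 z1 m4).
  by rewrite divnDr // divnn addn1 addn1 ltnS IH.
(* the step from A_4 is not available, but A_6 lies in A_7 and 6 %/ 3 = 7 %/ 3 *)
have [n7|n7] := eqVneq n 7%N.
  have s3 := step 3%N isT; rewrite n7 in s3 *.
  by apply: leq_trans (s3 isT) _; apply: ed_Alt_mono.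
by have := step (n - 3)%N; rewrite subnK //; apply; lia.
Qed.

Lemma cube_root_extension (K : fieldType) : 3%:R != 0 :> K ->
  exists (K' : fieldType) (j : {rmorphism K -> K'}) (zeta : K'),
    zeta ^+ 3 = 1 /\ zeta != 1.
Proof.
move=> K3; pose p : {poly K} := 'X^2 + 'X + 1.
have root_cube (E : fieldType) (x : E) : 3%:R != 0 :> E ->
    x ^+ 2 + x + 1 = 0 -> x ^+ 3 = 1 /\ x != 1.
  move=> E3 x0; split.
    apply/eqP; rewrite -subr_eq0; apply/eqP.
    by transitivity ((x - 1) * (x ^+ 2 + x + 1)); [ring|rewrite x0 mulr0].
  by apply: contra_neq E3 => x1; rewrite -x0 x1; ring.
have sp : size p = 3%N.
  by rewrite /p -addrA -polyC1 size_polyDl size_polyXn // size_XaddC.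
have [[x px]|nr] := pselect (exists x, root p x).
  exists K, idfun, x; apply: root_cube => //.
  by move: px; rewrite /root /p !hornerE => /eqP.
have irr : irreducible_poly p.
  apply: cubic_irreducible; first by rewrite sp.
  by move=> x; apply/negP => px; apply: nr; exists x.
have [E _ [x rx _]] := irredp_FAdjoin irr.
exists E, (in_alg E), x; apply: root_cube.
  by rewrite -(rmorph_nat (in_alg E)) fmorph_eq0.
move: rx; rewrite /p !rmorphD rmorphXn rmorph1 /= map_polyX /root !hornerE.
by move/eqP.
Qed.

Local Close Scope classical_set_scope.
Local Close Scope ring_scope.
Local Open Scope nat_scope.

Theorem theorem5p6 :
  (forall K : fieldType, 2 \notin [pchar K]%R ->
    [/\ ed_Alt K 3 = 1,
        ed_Alt K 4 = 2 /\ ed_Alt K 5 = 2,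
        forall n : nat, 4 <= n -> ed_Alt K n + 2 <= ed_Alt K (n + 4) &
        forall n : nat, 3 <= n -> 2 * (n %/ 4) <= ed_Alt K n]) /\
  (forall K : fieldType, contains_F4 K ->
    forall n : nat, 0 < n -> n != 4 ->
      ed_Alt K n + 1 <= ed_Alt K (n + 3)) /\
  (forall K : fieldType, 2 \in [pchar K]%R ->
    forall n : nat, 3 <= n -> n %/ 3 <= ed_Alt K n).
Proof.
split; [|split].
- move=> K; rewrite inE /= => K2.
  have ed3 : ed_Alt K 3 = 1.
    by apply/eqP; rewrite eqn_leq ed_Alt3_gt0 andbT; apply: (ed_AltP K 3).2; apply: ed_le_alt3.
  have le5 : ed_Alt K 5 <= 2 by apply: (ed_AltP K 5).2; apply: ed_le_alt5.
  have le45 : ed_Alt K 4 <= ed_Alt K 5 by apply: ed_Alt_mono.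
  have ge4 : 2 <= ed_Alt K 4.
    by have [||e -> _] := ed_le_alt_four K2 _ _ (ed_AltP K (0 + 4)).1.
  have ed4 : ed_Alt K 4 = 2 by apply/eqP; rewrite eqn_leq ge4 (leq_trans le45).
  have step n : 4 <= n -> ed_Alt K n + 2 <= ed_Alt K (n + 4).
    rewrite leq_eqVlt => /orP[/eqP <-|n5].
      (* n = 4: the bound for (Z/2)^4 meets the known value for A_4 *)
    by rewrite ed4; apply: ed_le_alt8 K2 _ (ed_AltP K (4 + 4)).1.
    have [||e -> h] := ed_le_alt_four K2 _ _ (ed_AltP K (n + 4)).1; [lia|lia|].
    by rewrite addn2 !ltnS; apply: (ed_AltP K n).2.
  split=> //; first by split=> //; apply/eqP; rewrite eqn_leq le5 (leq_trans ge4).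
  move=> n _; elim/ltn_ind: n => n IH.
  have [n4|n4] := ltnP n 4; first by rewrite divn_small.
  have [n8|n8] := ltnP n 8.
    apply: leq_trans (ed_Alt_mono K n4); rewrite ed4.
    by have : n %/ 4 < 2 by [rewrite ltn_divLR]; case: (n %/ 4) => [|[]].
  have := step (n - 4); rewrite subnK // => /(_ _) H.
  apply: leq_trans (H _); last by lia.
  have -> : n %/ 4 = (n - 4) %/ 4 + 1 by lia.
  by rewrite mulnDr muln1 leq_add2r; apply: IH; lia.
- move=> K [F4 [c4 [j]]] n _ n4.
  have [z z0 z1] : exists2 z : F4, z != 0%R & z != 1%R.
    have : ~~ ([set: F4] \subset [set 0%R; 1%R])%SET.
      apply/negP => /subset_leq_card; rewrite finset.cardsT c4 cards2.
      by case: (_ != _).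
    by case/fintype.subsetPn => z _; rewrite !finset.inE negb_or => /andP[]; exists z.
  apply: (@ed_Alt_three K (j z)) => //.
    rewrite -rmorphXn -(rmorph1 j); congr (j _); apply: (mulfI z0).
    by rewrite mulr1 -exprS -[in RHS](expf_card z) c4.
  by apply: contra_neq z1 => jz; apply: (fmorph_inj j); rewrite jz rmorph1.
- move=> K /andP[_ /eqP K2] n _.
  have K3 : (3%:R != 0 :> K)%R.
    by rewrite (natrD _ 2 1) K2 add0r oner_neq0.
  have [K' [j [zeta [z3 z1]]]] := cube_root_extension K3.
  apply: leq_trans (ed_Alt_third n z3 z1) _.
  apply: (ed_AltP K' n).2; exact: (ed_le_base_change j (ed_AltP K n).1).
Qed.
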